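(* There is a constant $c>0$ such that the following holds. Let $0\le p_1=p_1(n),\,p_2=p_2(n)\le 1$ and let $H\sim L(n,p_1,p_2)$. (i) If $p_1p_2\le\frac{1}{cn\log n}$, then with high probability jigsaw percolation on $H$ does not percolate. (ii) If $p_1p_2\ge\frac{c}{n\log n}$ and $\min\{p_1,p_2\}\ge\frac{c\log n}{n}$, then with high probability jigsaw percolation on $H$ percolates.
   Context: $L(n,p_1,p_2)$ is the random double graph whose vertex set is the set of $2$-element subsets of $[n]$; any two distinct vertices that intersect (share an element of $[n]$) form a red edge with probability $p_1$ and a blue edge with probability $p_2$, independently of each other and of all other pairs; disjoint vertices are never adjacent. Jigsaw percolation on a double graph: start with every vertex in its own cluster; at each time step form an auxiliary graph on the clusters where distinct clusters $C,C'$ are adjacent iff there is a red edge between a vertex of $C$ and a vertex of $C'$ and a blue edge between a vertex of $C$ and a vertex of $C'$; stop if this graph has no edges, otherwise merge the clusters in each connected component, and stop if a single cluster remains. The double graph percolates if the process ends with a single cluster. ''With high probability'' means with probability tending to $1$ as $n\to\infty$. *)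

(* Defs.v *)
From HB Require Import structures.
From mathcomp Require Import all_boot all_order all_algebra.
From mathcomp Require Import boolp reals.

Set Implicit Arguments.
Unset Strict Implicit.
Unset Printing Implicit Defensive.

Import Order.TTheory GRing.Theory Num.Theory.

Local Open Scope ring_scope.

(* An edge between x and y is the unordered pair [set x; y]; the two edge sets
   are unrelated, so a pair of vertices may be both a red and a blue edge. *)
Record doubleGraph (T : finType) := DoubleGraph {
  red : {set {set T}};
  blue : {set {set T}}
}.

Section Jigsaw.
Variables (T : finType) (H : doubleGraph T).
Implicit Types (C D : {set T}) (P : {set {set T}}).

Definition edge_between (F : {set {set T}}) C D : bool :=
  [exists x in C, exists y in D, [set x; y] \in F].

Definition cluster_adj P : rel {set T} := fun C D =>
  [&& C \in P, D \in P, C != D,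
      edge_between (red H) C D & edge_between (blue H) C D].

Definition merge P C : {set T} :=
  \bigcup_(D in P | connect (cluster_adj P) C D) D.

(* When no two clusters of P are adjacent this is P itself, so stopping the
   process is the same as letting it remain constant. *)
Definition jigsaw_step P : {set {set T}} := [set merge P C | C in P].

Definition jigsaw_clusters (t : nat) : {set {set T}} :=
  iter t jigsaw_step [set [set x] | x in [set: T]].

Definition percolates : Prop := exists t : nat, #|jigsaw_clusters t| = 1%N.

End Jigsaw.

Definition Lvertex (n : nat) : finType := {A : {set 'I_n} | #|A| == 2%N}.

Definition Ledge (n : nat) : {set {set Lvertex n}} :=
  [set e | [exists A : Lvertex n, exists B : Lvertex n,
     [&& A != B, val A :&: val B != set0 & e == [set A; B]]]].

(* Probability that the random subset of E containing each element of E
   independently with probability p is equal to F. *)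
Definition bernoulli_weight (R : realType) (T : finType) (E : {set T}) (p : R)
    (F : {set T}) : R :=
  if F \subset E then \prod_(e in E) (if e \in F then p else 1 - p) else 0.

Definition L_prob (R : realType) (n : nat) (p1 p2 : R)
    (Q : doubleGraph (Lvertex n) -> Prop) : R :=
  \sum_(F1 : {set {set Lvertex n}})
    \sum_(F2 : {set {set Lvertex n}} | `[< Q (DoubleGraph F1 F2) >])
      bernoulli_weight (Ledge n) p1 F1 * bernoulli_weight (Ledge n) p2 F2.

(* Main.v *)
Require Import Defs.
From HB Require Import structures.
From mathcomp Require Import all_boot all_order all_algebra.
From mathcomp Require Import boolp reals.
From mathcomp Require Import ring lra zify.

(* Write V for the set of pairs of elements of [n].

   (i) If the process percolates then, since a cluster is built by successive
   merges of sets connected in both colours, for every K <= |V| some set S of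
   size in [K, 2K) is connected in both colours.  With k = |S| = m + 1, label S in all
   k! ways; each labelling carries a red and a blue spanning tree, given by
   parent maps.  There are at most k^m parent maps of each colour, and given
   the red one at most |V| (2n + 1)^m labellings, so
     k! Pr (S exists) <= |V| (k^2 (2n + 1) p1 p2)^m.
   As k! >= (k / e)^k this is O(n^-2) once K is about 4 ln n.

   (ii) Assume p2 <= p1.  The pairs containing a fixed g form a clique (the star
   of g), stars are edge-disjoint, and two stars share a vertex.  Split [n] into
   halves U and W.  For g in W, explore the vertices {g, u}, u in U, one at a
   time, keeping those with a red and a blue edge to the current cluster.  Every
   step uses fresh edges, so the cluster size is a pure birth chain with rates
   r_a = (1 - (1 - p1)^a) (1 - (1 - p2)^a).  The first (ln n) / 10 levels are
   passed with probability of order at least n^-0.3, and Markov's inequality for the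
   hitting time shows that the chain then reaches M = 2 ln n / p1 with
   probability at least 1/2; a cluster of that size has red edges to all {g, w},
   w in W.  Call such a star good.  Since blue edges connect {{g, w} : w in W}
   and attach {g, u} to it with high probability, a good star ends up in one
   cluster, and all good stars in the same one.  Stars being independent, each
   pair {i, j} has a red edge to {j, g} for some good g, except with probability
   (1 - Pr (good) p1)^(n / 2 - 2) <= n^-3; blue connectivity then absorbs all. *)

Set Implicit Arguments.
Unset Strict Implicit.
Unset Printing Implicit Defensive.

Import Order.TTheory GRing.Theory Num.Theory.

Local Open Scope ring_scope.

(** * Product Bernoulli measures on a finite set *)

Section ProductMeasure.
Variables (R : realFieldType) (I : finType) (p : I -> R).
Implicit Types (F G J A B : {set I}) (f g : {set I} -> R) (P Q : pred {set I}).

Definition wt F : R := \prod_i (if i \in F then p i else 1 - p i).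

Definition Ex f : R := \sum_F wt F * f F.

Definition Pr Q : R := Ex (fun F => (Q F)%:R).

Definition supported (T : Type) A (f : {set I} -> T) :=
  forall F, f F = f (F :&: A).

Lemma eq_Ex f g : f =1 g -> Ex f = Ex g.
Proof. by move=> fg; apply: eq_bigr => F _; rewrite fg. Qed.

Lemma eq_Pr P Q : P =1 Q -> Pr P = Pr Q.
Proof. by move=> PQ; apply: eq_Ex => F; rewrite PQ. Qed.

Lemma ExD f g : Ex (fun F => f F + g F) = Ex f + Ex g.
Proof. by rewrite -big_split; apply: eq_bigr => F _; rewrite mulrDr. Qed.

Lemma ExZ a f : Ex (fun F => a * f F) = a * Ex f.
Proof. by rewrite big_distrr; apply: eq_bigr => F _; rewrite mulrCA. Qed.

Lemma ExN f : Ex (fun F => - f F) = - Ex f.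
Proof. by rewrite -sumrN; apply: eq_bigr => F _; rewrite mulrN. Qed.

Lemma ExB f g : Ex (fun F => f F - g F) = Ex f - Ex g.
Proof. by rewrite ExD ExN. Qed.

Lemma Ex_sum (K : Type) (r : seq K) (P : pred K) (f : K -> {set I} -> R) :
  Ex (fun F => \sum_(k <- r | P k) f k F) = \sum_(k <- r | P k) Ex (f k).
Proof.
by rewrite exchange_big; apply: eq_bigr => F _; rewrite big_distrr.
Qed.

(** Expanding a product of two-term sums gives one term per subset of indices. Total mass, inclusion
    and avoidance probabilities are all instances. *)
Lemma Ex_prod (a b : I -> R) :
  Ex (fun F => \prod_i (if i \in F then a i else b i)) =
  \prod_i (p i * a i + (1 - p i) * b i).
Proof.
rewrite bigA_distr; apply: eq_bigr => F _.
by rewrite -big_split; apply: eq_bigr => i _ /=; case: ifP.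
Qed.

Lemma Ex_cst a : Ex (fun=> a) = a.
Proof.
rewrite (@eq_Ex _ (fun F => a * \prod_i (if i \in F then 1 else 1))); last first.
  by move=> F; rewrite big1 ?mulr1 // => i _; case: ifP.
rewrite ExZ Ex_prod big1 ?mulr1 // => i _; ring.
Qed.

Lemma Pr_predC Q : Pr (fun F => ~~ Q F) = 1 - Pr Q.
Proof.
rewrite -[in RHS](Ex_cst 1) -ExB; apply: eq_Ex => F.
by case: (Q F); rewrite ?subrr ?subr0.
Qed.

Lemma Pr_subset J : Pr (fun F => J \subset F) = \prod_(i in J) p i.
Proof.
rewrite /Pr (@eq_Ex _
  (fun F => \prod_i (if i \in F then 1 else (i \notin J)%:R))).
  rewrite Ex_prod [RHS]big_mkcond; apply: eq_bigr => i _ /=.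
  by case: ifP => _ /=; ring.
move=> F; have [JF|] := boolP (J \subset F).
  rewrite big1 // => i _; case: ifP => // /negbT iF.
  by rewrite (contra ((subsetP JF) i) iF).
case/subsetPn=> i iJ iF; rewrite (bigD1 i) //= (negbTE iF) iJ /=.
by rewrite mul0r.
Qed.

Lemma Pr_disjoint J : Pr (fun F => [disjoint J & F]) = \prod_(i in J) (1 - p i).
Proof.
rewrite /Pr (@eq_Ex _
  (fun F => \prod_i (if i \in F then (i \notin J)%:R else 1))).
  rewrite Ex_prod [RHS]big_mkcond; apply: eq_bigr => i _ /=.
  by case: ifP => _ /=; ring.
move=> F; have [JF|] := boolP [disjoint J & F].
  rewrite big1 // => i _; case: ifP => // iF.
  by rewrite (disjointFl JF iF).
case/pred0Pn=> i /andP[/= iJ iF]; rewrite (bigD1 i) //= iF iJ /=.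
by rewrite mul0r.
Qed.

(* Exchanging the A-parts of two independent samples F and G preserves the
   product weight, and turns f F * g G into (f * g) of a single sample. *)
Lemma Ex_indep A B f g : [disjoint A & B] -> supported A f -> supported B g ->
  Ex (fun F => f F * g F) = Ex f * Ex g.
Proof.
move=> AB fA gB; symmetry.
pose sw (u : {set I} * {set I}) :=
  ((u.1 :&: A) :|: (u.2 :\: A), (u.2 :&: A) :|: (u.1 :\: A)).
have swK : involutive sw.
  case=> F G; rewrite /sw /=; congr (_, _); apply/setP=> i; rewrite !inE;
  by case: (i \in A); case: (i \in F); case: (i \in G).
rewrite big_distrlr pair_big /= (reindex_inj (inv_inj swK)) /=.
rewrite -[LHS]/(\sum_(u : {set I} * {set I}) _).
transitivity (\sum_(u : {set I} * {set I}) (wt u.1 * (f u.1 * g u.1)) * wt u.2).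
  apply: eq_bigr => -[F G] _ /=.
  have -> : f ((F :&: A) :|: (G :\: A)) = f F.
    rewrite fA [RHS]fA; congr f; apply/setP=> i; rewrite !inE.
    by case: (i \in A); case: (i \in F); case: (i \in G).
  have -> : g ((G :&: A) :|: (F :\: A)) = g F.
    rewrite gB [RHS]gB; congr g; apply/setP=> i; rewrite !inE.
    case iB: (i \in B); rewrite ?andbF // (disjointFl AB iB) /=.
    by case: (i \in F); case: (i \in G).
  have e : wt ((F :&: A) :|: (G :\: A)) * wt ((G :&: A) :|: (F :\: A))
         = wt F * wt G.
    rewrite /wt -!big_split; apply: eq_bigr => i _ /=; rewrite !inE.
    by case: (i \in A); case: (i \in F); case: (i \in G) => //=; ring.
  by rewrite mulrACA e; ring.
rewrite -(pair_bigA _ (fun F G => wt F * (f F * g F) * wt G)) /=.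
apply: eq_bigr => F _; rewrite -big_distrr /=.
have -> : \sum_G wt G = Ex (fun=> 1) by apply: eq_bigr => G _; rewrite mulr1.
by rewrite Ex_cst mulr1.
Qed.

Lemma Pr_indep A B P Q : [disjoint A & B] -> supported A P -> supported B Q ->
  Pr (fun F => P F && Q F) = Pr P * Pr Q.
Proof.
move=> AB PA QB; rewrite -(Ex_indep AB).
- by apply: eq_Ex => F; rewrite -natrM mulnb.
- by move=> F; rewrite PA.
- by move=> F; rewrite QB.
Qed.

Lemma supportedS (T : Type) A B (f : {set I} -> T) :
  A \subset B -> supported A f -> supported B f.
Proof. by move=> AB fA F; rewrite fA [RHS]fA -setIA (setIidPr AB). Qed.

Lemma Pr_all_indep (K : finType) (s : seq K) (A : K -> {set I})
    (Q : K -> pred {set I}) : uniq s ->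
  (forall k, supported (A k) (Q k)) ->
  {in s &, forall k l, k != l -> [disjoint A k & A l]} ->
  Pr (fun F => all (Q^~ F) s) = \prod_(k <- s) Pr (Q k).
Proof.
move=> us QA; elim: s us => [|k s IH] /= => [_ _|/andP[ks us] dis].
  by rewrite big_nil -[RHS]Ex_cst.
rewrite big_cons -IH //; last first.
  by move=> i j si sj; apply: dis; rewrite inE ?si ?sj orbT.
apply: (@Pr_indep (A k) (\bigcup_(l in s) A l)) => //.
- rewrite disjoint_sym disjoint_subset; apply/subsetP => x.
  move=> /bigcupP[l ls xl]; rewrite inE /=.
  have lk : l != k by apply: contraNneq ks => <-.
  by rewrite (disjointFr (dis l k _ _ lk) xl) // inE ?eqxx // ls orbT.
- move=> F; apply: eq_in_all => l ls.
  by apply: (supportedS _ (QA l)); apply: bigcup_sup.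
Qed.

Hypothesis p01 : forall i, 0 <= p i <= 1.

Lemma wt_ge0 F : 0 <= wt F.
Proof.
apply: prodr_ge0 => i _; have /andP[p0 p1] := p01 i.
by case: ifP => _ //; rewrite subr_ge0.
Qed.

Lemma le_Ex f g : (forall F, f F <= g F) -> Ex f <= Ex g.
Proof.
by move=> fg; apply: ler_sum => F _; apply: ler_wpM2l; rewrite ?wt_ge0.
Qed.

Lemma le_Pr P Q : (forall F, P F -> Q F) -> Pr P <= Pr Q.
Proof.
move=> PQ; apply: le_Ex => F; rewrite ler_nat.
by have := PQ F; case: (P F); case: (Q F) => //= /(_ isT).
Qed.

Lemma Pr_ge0 Q : 0 <= Pr Q.
Proof. by rewrite -(Ex_cst 0); apply: le_Ex => F; rewrite ler0n. Qed.

Lemma Pr_le1 Q : Pr Q <= 1.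
Proof. by rewrite -(Ex_cst 1); apply: le_Ex => F; rewrite lern1; case: (Q F). Qed.

Lemma Pr_orb P Q : Pr (fun F => P F || Q F) <= Pr P + Pr Q.
Proof.
rewrite /Pr -ExD; apply: le_Ex => F; rewrite -natrD ler_nat.
by case: (P F); case: (Q F).
Qed.

Lemma Pr_exists (K : finType) (D : pred K) (Q : K -> pred {set I}) :
  Pr (fun F => [exists k, D k && Q k F]) <= \sum_(k | D k) Pr (Q k).
Proof.
rewrite /Pr -(Ex_sum _ _ (fun k F => (Q k F)%:R)); apply: le_Ex => F.
have [/existsP[k /andP[Dk Qk]]|_] := boolP [exists k, D k && Q k F]; last first.
  by apply: sumr_ge0 => k _; rewrite ler0n.
by rewrite (bigD1 k) //= Qk lerDl sumr_ge0 // => j _; rewrite ler0n.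
Qed.

End ProductMeasure.

(** * Deterministic jigsaw percolation *)

Section Connectivity.
Variable T : finType.
Implicit Types (F : {set {set T}}) (A B S : {set T}).

Lemma edge_betweenP F A B :
  reflect (exists x y, [/\ x \in A, y \in B & [set x; y] \in F])
          (edge_between F A B).
Proof.
apply: (iffP exists_inP) => [[x xA /exists_inP[y yB e]]|[x [y [xA yB e]]]].
  by exists x, y.
by exists x => //; apply/exists_inP; exists y.
Qed.

Lemma edge_between_sym F A B : edge_between F A B = edge_between F B A.
Proof.
by apply/edge_betweenP/edge_betweenP=> -[x [y [xA yB e]]]; exists y, x;
  rewrite setUC.
Qed.

Lemma edge_betweenS F A A' B B' : A \subset A' -> B \subset B' ->
  edge_between F A B -> edge_between F A' B'.
Proof.
move=> /subsetP sA /subsetP sB /edge_betweenP[x [y [xA yB e]]].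
by apply/edge_betweenP; exists x, y; rewrite sA ?sB.
Qed.

(** Connectivity stated through cuts instead of paths: unions and union bounds over cuts become
    direct. The empty set and singletons qualify. *)
Definition cut_connected F S :=
  [forall A : {set T}, (A \proper S) && (A != set0) ==>
     edge_between F A (S :\: A)].

Lemma cut_connectedP F S :
  reflect (forall A, A \proper S -> A != set0 -> edge_between F A (S :\: A))
          (cut_connected F S).
Proof.
apply: (iffP forallP) => [h A AS A0|h A]; first by have := h A; rewrite AS A0.
by apply/implyP=> /andP[AS A0]; exact: h.
Qed.

Lemma cut_connected1 F x : cut_connected F [set x].
Proof.
apply/cut_connectedP => A; rewrite properE subset1 => /andP[/orP[] /eqP->].
  by rewrite subxx.
by rewrite eqxx.
Qed.

(** A cut X of the union either splits A or B, and an edge inside that part crosses it, or contains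
    one part and misses the other, and the edge between A and B crosses it. *)
Lemma cut_connectedU F A B : cut_connected F A -> cut_connected F B ->
  edge_between F A B -> cut_connected F (A :|: B).
Proof.
have dich C S X : cut_connected F C -> C \subset S ->
    edge_between F X (S :\: X) \/ (C :&: X = set0) \/ (C \subset X).
  move=> /cut_connectedP cC CS.
  have [|h0] := eqVneq (C :&: X) set0; first by right; left.
  have [|h1] := boolP (C \subset X); first by right; right.
  left; have := cC (C :&: X); rewrite properE subsetIl subsetI subxx h1 h0.
  move/(_ isT isT); apply: edge_betweenS; first exact: subsetIr.
  by rewrite setDIr setDv set0U; apply: setSD.
move=> cA cB eAB; apply/cut_connectedP => X XS X0.
have [//|hA] := dich A (A :|: B) X cA (subsetUl _ _).
have [//|hB] := dich B (A :|: B) X cB (subsetUr _ _).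
have XE : X = (A :&: X) :|: (B :&: X).
  by rewrite -setIUl; apply/esym/setIidPr/proper_sub.
case: hA => hA; case: hB => hB.
- by case/negP: X0; rewrite XE hA hB setU0.
- move: eAB; rewrite edge_between_sym; apply: edge_betweenS => //.
  by rewrite subsetD subsetUl -setI_eq0 hA eqxx.
- move: eAB; apply: edge_betweenS => //.
  by rewrite subsetD subsetUr -setI_eq0 hB eqxx.
- by move: XS; rewrite properE subUset hA hB andbF.
Qed.

End Connectivity.

(** * Clusters along the jigsaw process and at its end *)

Section Process.
Variables (T : finType) (H : doubleGraph T).
Implicit Types (C D S : {set T}) (P Q : {set {set T}}).

Definition doubly_connected S :=
  cut_connected (red H) S && cut_connected (blue H) S.

Lemma cluster_adj_sym P : symmetric (cluster_adj H P).
Proof.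
move=> C D; rewrite /cluster_adj eq_sym andbCA; do 3!congr (_ && _).
by rewrite ![edge_between _ C D]edge_between_sym.
Qed.

(** Inside the component of C, take a maximal family Q containing C whose union is doubly connected
    and smaller than K. Adding an adjacent cluster keeps the union doubly connected and below 2K,
    hence below K by the gap. So Q is closed under adjacency and is the whole component. *)
Lemma jigsaw_step_small (K : nat) P :
  (forall S, doubly_connected S -> (#|S| < K.*2 -> #|S| < K)%N) ->
  (forall C, C \in P -> doubly_connected C /\ (#|C| < K)%N) ->
  forall C, C \in jigsaw_step H P -> doubly_connected C /\ (#|C| < K)%N.
Proof.
move=> gap smallP _ /imsetP[C CP ->].
pose comp := [set D in P | connect (cluster_adj H P) C D].
pose q Q := [&& C \in Q, Q \subset comp, doubly_connected (cover Q)
              & (#|cover Q| < K)%N].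
have qC : q [set C].
  rewrite /q set11 sub1set inE CP connect0 /cover big_set1 /=.
  by have [-> ->] := smallP C CP.
have [Q /maxsetP[/and4P[CQ Qc dcQ QK] Qmax] _] := maxset_exists qC.
have Qclosed D D' : cluster_adj H P D D' -> D \in Q -> D' \in Q.
  move=> DD' DQ; apply: contraT => D'Q.
  have /and5P[DP D'P _ redD blueD] := DD'.
  have [dcD' D'K] := smallP D' D'P.
  have cE : cover (D' |: Q) = cover Q :|: D'.
    by rewrite /cover bigcup_setU big_set1 setUC.
  have DsQ : D \subset cover Q by apply: bigcup_sup.
  have dc : doubly_connected (cover (D' |: Q)).
    move: dcQ dcD' => /andP[r1 b1] /andP[r2 b2].
    rewrite cE /doubly_connected !cut_connectedU //.
      exact: edge_betweenS blueD.
    exact: edge_betweenS redD.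
  have lt2 : (#|cover (D' |: Q)| < K.*2)%N.
    by rewrite cE (leq_ltn_trans (leq_card_setU _ _)) // -addnn -addSn leq_add // ltnW.
  have qQ' : q (D' |: Q).
    rewrite /q !inE CQ orbT dc (gap _ dc lt2) subUset Qc sub1set inE D'P /= ?andbT.
    apply: connect_trans (connect1 DD').
    by have := subsetP Qc D DQ; rewrite inE => /andP[].
  by rewrite -(Qmax _ qQ' (subsetUr _ _)) setU11 in D'Q.
have -> : Defs.merge H P C = cover Q; last by split.
suff -> : Q = comp by apply: eq_bigl => D; rewrite inE.
apply/eqP; rewrite eqEsubset Qc; apply/subsetP => D; rewrite inE => /andP[_ cD].
rewrite -(closed_connect _ cD) //; apply: intro_closed; last exact: Qclosed.
exact/sym_connect_sym/cluster_adj_sym.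
Qed.

Lemma sub_merge P C : C \in P -> C \subset Defs.merge H P C.
Proof. by move=> CP; apply: bigcup_sup; rewrite CP connect0. Qed.

Lemma cover_jigsaw_step P : cover P = [set: T] ->
  cover (jigsaw_step H P) = [set: T].
Proof.
move=> cP; apply/setP=> x; rewrite inE; apply/bigcupP.
have : x \in cover P by rewrite cP inE.
case/bigcupP=> C CP xC; exists (Defs.merge H P C); first exact: imset_f.
by apply: (subsetP (sub_merge CP)).
Qed.

Lemma cover_jigsaw_clusters t : cover (jigsaw_clusters H t) = [set: T].
Proof.
elim: t => [|t IH] /=; last exact: cover_jigsaw_step.
apply/setP=> x; rewrite inE; apply/bigcupP; exists [set x]; rewrite ?inE //.
exact: imset_f.
Qed.

(* The cluster sizes cannot jump over the window [K, 2K). *)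
Lemma percolates_doubly_connected (K : nat) : percolates H ->
  (0 < K <= #|T|)%N ->
  exists S, doubly_connected S /\ (K <= #|S| < K.*2)%N.
Proof.
move=> [t Pt1] /andP[K0 KT]; apply: contrapT => noS.
have gap S : doubly_connected S -> (#|S| < K.*2 -> #|S| < K)%N.
  move=> dS S2K; rewrite ltnNge; apply/negP=> KS.
  by apply: noS; exists S; rewrite KS.
have small : forall C, C \in jigsaw_clusters H t ->
    doubly_connected C /\ (#|C| < K)%N.
  elim: {Pt1} t => [|t IH] /=; last exact: jigsaw_step_small.
  move=> _ /imsetP[x _ ->]; have dcx : doubly_connected [set x].
    by rewrite /doubly_connected !cut_connected1.
  by split=> //; apply: gap => //; rewrite cards1; lia.
have [C PtC] := cards1P (introT eqP Pt1).
have := cover_jigsaw_clusters t; rewrite PtC /cover big_set1 => CT.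
have [_] : doubly_connected C /\ (#|C| < K)%N by apply: small; rewrite PtC set11.
by rewrite CT cardsT ltnNge KT.
Qed.

Lemma merge_eq P C D : connect (cluster_adj H P) C D -> Defs.merge H P C = Defs.merge H P D.
Proof.
move=> CD; apply: eq_bigl => E; congr (_ && _).
exact: (same_connect (sym_connect_sym (@cluster_adj_sym P)) CD).
Qed.

Lemma jigsaw_step_partition P : partition P [set: T] ->
  partition (jigsaw_step H P) [set: T].
Proof.
move=> /and3P[/eqP cP tP nP]; apply/and3P; split.
- by rewrite cover_jigsaw_step.
- apply/trivIsetP => _ _ /imsetP[C CP ->] /imsetP[D DP ->] neq.
  rewrite -setI_eq0; apply: contraNT neq => /set0Pn[x].
  rewrite inE => /andP[/bigcupP[E /andP[EP CE] xE] /bigcupP[E' /andP[E'P DE] xE']].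
  have EE' : E = E' by rewrite -(def_pblock tP EP xE) (def_pblock tP E'P xE').
  by rewrite (merge_eq CE) (merge_eq DE) EE'.
- apply/imsetP => -[C CP C0].
  by have := sub_merge CP; rewrite -C0 subset0 => /eqP E; rewrite -E CP in nP.
Qed.

Lemma jigsaw_clusters_partition t : partition (jigsaw_clusters H t) [set: T].
Proof.
elim: t => [|t IH] /=; last exact: jigsaw_step_partition.
apply/and3P; split.
- by apply/eqP; exact: (cover_jigsaw_clusters 0).
- apply/trivIsetP => _ _ /imsetP[x _ ->] /imsetP[y _ ->] neq.
  by rewrite disjoints1 inE; apply: contraNneq neq => ->.
- by apply/imsetP => -[x _] /setP/(_ x); rewrite !inE eqxx.
Qed.

(** As long as two clusters are adjacent, they have the same image under [merge], so the number of
    clusters drops; this cannot go on forever. *)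
Lemma jigsaw_stabilizes :
  exists t, forall C D, ~~ cluster_adj H (jigsaw_clusters H t) C D.
Proof.
apply: contrapT => unstable.
have dec t : (#|jigsaw_clusters H t| + t <= #|jigsaw_clusters H 0|)%N.
  elim: t => [|t IH]; first by rewrite addn0.
  apply: leq_trans IH; rewrite addnS -addSn leq_add2r.
  have [C [D CD]] : exists C D, cluster_adj H (jigsaw_clusters H t) C D.
    apply: contrapT => none; apply: unstable; exists t => C D.
    by apply/negP => CD; apply: none; exists C, D.
  rewrite ltn_neqAle leq_imset_card andbT; apply/negP => /imset_injP inj.
  have /and4P[CP DP CneD _] := CD.
  by move: CneD; rewrite (inj C D CP DP (merge_eq (connect1 CD))) eqxx.
have := dec #|jigsaw_clusters H 0|.+1; lia.
Qed.

(** The trace on single vertices of the stopping condition; the percolation argument for good stars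
    uses nothing else about the process. *)
Definition absorbing C := forall y,
  (exists2 x, x \in C & [set x; y] \in red H) ->
  (exists2 x, x \in C & [set x; y] \in blue H) -> y \in C.

(** Removes the time from the problem: when the process has stopped, a vertex y with red and blue
    neighbours in C has its own cluster adjacent to C unless the two coincide, so every cluster is
    absorbing. *)
Lemma percolates_of_absorbing :
  (forall P, partition P [set: T] -> (forall C, C \in P -> absorbing C) ->
    exists2 C, C \in P & C = [set: T]) ->
  percolates H.
Proof.
move=> h; have [t st] := jigsaw_stabilizes; exists t.
have pP := jigsaw_clusters_partition t.
set P := jigsaw_clusters H t in st pP *.
have /and3P[/eqP cP tP nP] := pP.
have [C CP y [x xC rxy] [x' x'C bxy]|C CP CT] := h P pP.
  have : y \in cover P by rewrite cP inE.
  case/bigcupP=> D DP yD; have [->//|CD] := eqVneq C D.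
  have /negP[] := st C D; rewrite /cluster_adj CP DP CD /=.
  by apply/andP; split; apply/edge_betweenP; [exists x, y|exists x', y].
apply/eqP/cards1P; exists C; apply/setP => D; rewrite inE.
apply/idP/eqP => [DP|-> //].
case: (set_0Vmem D) => [D0|[x xD]]; first by rewrite D0 in DP; rewrite DP in nP.
have xC : x \in C by rewrite CT inE.
by rewrite -(def_pblock tP DP xD) (def_pblock tP CP xC).
Qed.

(* The finishing argument: a blue path out of C can be followed because every
   vertex of S already has a red edge to C. *)
Lemma absorbing_cut_connected C S : absorbing C -> cut_connected (blue H) S ->
  (forall y, y \in S -> y \notin C -> exists2 x, x \in C & [set x; y] \in red H) ->
  S :&: C != set0 -> S \subset C.
Proof.
move=> aC /cut_connectedP cS redS SC0; apply: contraT => SnC.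
have := cS (S :&: C); rewrite properE subsetIl subsetI subxx SnC SC0.
move=> /(_ isT isT)/edge_betweenP[x [y []]].
rewrite !inE => /andP[xS xC] /andP[]; rewrite negb_and => /orP[/negP//|yC] yS bl.
by move: (yC); rewrite aC //; [exact: redS|exists x].
Qed.

End Process.

(** The adjacency of clusters is symmetric in the colours; this is what allows the assumption p2 <=
    p1 later. *)
Lemma percolates_swap (T : finType) (F1 F2 : {set {set T}}) :
  percolates (DoubleGraph F1 F2) -> percolates (DoubleGraph F2 F1).
Proof.
move=> [t e]; exists t; rewrite -e; congr (#|pred_of_set _|); clear e.
have adjE P : cluster_adj (DoubleGraph F2 F1) P =2 cluster_adj (DoubleGraph F1 F2) P.
  by move=> C D; rewrite /cluster_adj; do 3!congr (_ && _); rewrite andbC.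
elim: t => //= t ->; apply: eq_imset => C; apply: eq_bigl => D.
by rewrite (eq_connect (adjE _)).
Qed.

(** * Random double graphs *)

Section Layers.
Variable V : finType.
Implicit Types (F : {set {set V} * bool}) (L : {set {set V}}).

(* The coordinate (e, true) stands for the edge e in red, (e, false) in blue. *)
Definition layer (b : bool) F : {set {set V}} := [set e | (e, b) \in F].

Definition dgraph F := DoubleGraph (layer true F) (layer false F).

(** Every set of vertices is a coordinate; those outside L get probability 0, so they are almost
    surely absent. *)
Definition edge_prob (R : realFieldType) (p1 p2 : R) L (x : {set V} * bool) : R :=
  if x.1 \in L then (if x.2 then p1 else p2) else 0.

Lemma edge_prob01 (R : realFieldType) (p1 p2 : R) L x :
  0 <= p1 <= 1 -> 0 <= p2 <= 1 -> 0 <= edge_prob p1 p2 L x <= 1.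
Proof. by rewrite /edge_prob; case: ifP => _; [case: ifP|rewrite lexx ler01]. Qed.

End Layers.

(** A coordinate outside [Ledge n] contributes 1 when absent and 0 when present, which reproduces
    [bernoulli_weight]; the product over coloured edges then splits into a red and a blue weight. *)
Lemma L_probE (R : realType) n (p1 p2 : R) (Q : doubleGraph (Lvertex n) -> Prop) :
  L_prob p1 p2 Q =
  Pr (edge_prob p1 p2 (Ledge n)) (fun F => `[< Q (dgraph F) >]).
Proof.
pose V := Lvertex n.
have bwE (p : R) (F : {set {set V}}) : bernoulli_weight (Ledge n) p F =
    \prod_e (let q := if e \in Ledge n then p else 0 in
             if e \in F then q else 1 - q).
  rewrite /bernoulli_weight; case: ifP => [/subsetP FL|/negbT/subsetPn[e eF eL]].
    rewrite big_mkcond; apply: eq_bigr => e _ /=.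
    case: ifP => //= eL; rewrite subr0; case: ifP => // eF.
    by rewrite FL in eL.
  by rewrite (bigD1 e) //= (negbTE eL) eF mul0r.
pose glue (u : {set {set V}} * {set {set V}}) : {set {set V} * bool} :=
  [set x | if x.2 then x.1 \in u.1 else x.1 \in u.2].
pose split (F : {set {set V} * bool}) := (layer true F, layer false F).
have glueK : cancel glue split.
  by case=> F1 F2; congr (_, _); apply/setP=> e; rewrite !inE.
have splitK : cancel split glue.
  by move=> F; apply/setP=> -[e []]; rewrite !inE.
have wtE F : wt (edge_prob p1 p2 (Ledge n)) F =
    bernoulli_weight (Ledge n) p1 (layer true F) *
    bernoulli_weight (Ledge n) p2 (layer false F).
  rewrite !bwE -big_split /wt /=.
  pose f e b := if (e, b) \in F then
    edge_prob p1 p2 (Ledge n) (e, b) else 1 - edge_prob p1 p2 (Ledge n) (e, b).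
  transitivity (\prod_x f x.1 x.2); first by apply: eq_bigr => -[].
  rewrite -(pair_bigA _ f) /f /=.
  by apply: eq_bigr => e _; rewrite big_bool /edge_prob /= !inE.
rewrite /Pr /Ex (reindex glue) /=; last by exists split => ? _.
pose f F1 F2 := wt (edge_prob p1 p2 (Ledge n)) (glue (F1, F2)) *
  `[< Q (dgraph (glue (F1, F2))) >]%:R.
transitivity (\sum_u f u.1 u.2); last by apply: eq_bigr => -[].
rewrite -(pair_bigA _ f) /f /L_prob /=.
apply: eq_bigr => F1 _; rewrite big_mkcond; apply: eq_bigr => F2 _.
have [e1 e2] : layer true (glue (F1, F2)) = F1 /\ layer false (glue (F1, F2)) = F2.
  by have := glueK (F1, F2); rewrite /split => -[-> ->].
rewrite wtE /dgraph e1 e2.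
by case: ifP => _; rewrite ?mulr1 ?mulr0.
Qed.

(** * Spanning trees *)

Lemma ler_sum_term (R : realFieldType) (K : finType) (D : pred K) (f : K -> R) k :
  (forall i, 0 <= f i) -> D k -> f k <= \sum_(i | D i) f i.
Proof. by move=> f0 Dk; rewrite (bigD1 k) //= lerDl sumr_ge0. Qed.

(** [g] is a parent map with root [ord0], the other vertices being [lift ord0 j]; a rank decreasing
    towards the parent excludes cycles. *)
Definition rooted m (g : {ffun 'I_m -> 'I_m.+1}) :=
  exists rk : 'I_m.+1 -> nat, forall j, (rk (g j) < rk (lift ord0 j))%N.

(** The tree is grown from the root: an edge across the cut of the current set A adds a vertex y
    with a parent x in A and rank one above that of x. *)
Lemma rooted_spanning_tree m (G : rel 'I_m.+1) :
  (forall A : {set 'I_m.+1}, A != set0 -> A != setT ->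
     exists x y, [/\ x \in A, y \notin A & G y x]) ->
  exists2 g, rooted g & forall j, G (lift ord0 j) (g j).
Proof.
move=> cutG.
have grow k : (k <= m)%N -> exists (A : {set 'I_m.+1}) (g : {ffun 'I_m -> 'I_m.+1})
    (rk : 'I_m.+1 -> nat), [/\ #|A| = k.+1, ord0 \in A &
    forall j, lift ord0 j \in A ->
      [/\ g j \in A, (rk (g j) < rk (lift ord0 j))%N & G (lift ord0 j) (g j)]].
  elim: k => [|k IH] km.
    exists [set ord0], [ffun=> ord0], (fun=> 0%N); split; rewrite ?cards1 ?set11 //.
    by move=> j; rewrite inE eq_sym (negbTE (neq_lift _ _)).
  have [A [g [rk [cA A0 gP]]]] := IH (ltnW km).
  have [||x [y [xA yA Gyx]]] := cutG A.
  - by apply/set0Pn; exists ord0.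
  - by apply: contraTneq km => AT; rewrite -leqNgt -ltnS -cA AT cardsT card_ord.
  have [jy yE|y0] := unliftP ord0 y; last by rewrite y0 A0 in yA.
  exists (y |: A), [ffun j => if j == jy then x else g j],
    (fun i => if i == y then (rk x).+1 else rk i).
  split; first by rewrite cardsU1 yA cA.
    by rewrite !inE A0 orbT.
  have neA z : z \in A -> (z == y) = false by move=> zA; apply: contraNF yA => /eqP<-.
  move=> j; rewrite !inE ffunE {1}yE (inj_eq lift_inj).
  have [->|jjy] := eqVneq j jy.
    by rewrite -yE eqxx xA orbT (neA x xA).
  move=> /= /gP[gA gr gG]; rewrite gA orbT (neA _ gA).
  by rewrite yE (inj_eq lift_inj) (negbTE jjy).
have [A [g [rk [cA A0 gP]]]] := grow m (leqnn m).
have AT : A = setT by apply/eqP; rewrite eqEcard subsetT cardsT card_ord cA leqnn.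
have inA j : lift ord0 j \in A by rewrite AT inE.
exists g => [|j]; last by have [] := gP j (inA j).
by exists rk => j; have [] := gP j (inA j).
Qed.

(** * Union bound over pairs of labelled spanning trees *)

Section TreeCount.
Variables (R : realFieldType) (V : finType) (L : {set {set V}}) (m : nat).
Variables (p1 p2 : R) (C : finType) (nb : V -> C -> V).
Hypotheses (p1_01 : 0 <= p1 <= 1) (p2_01 : 0 <= p2 <= 1).
Hypothesis nbP : forall x y, x != y -> [set x; y] \in L -> exists c, y = nb x c.
Implicit Types (s : {ffun 'I_m.+1 -> V}) (g : {ffun 'I_m -> 'I_m.+1}).

Let pL := edge_prob p1 p2 L.

Definition tree_edge s g (j : 'I_m) : {set V} := [set s (lift ord0 j); s (g j)].

Definition tree_edges (b : bool) s g : {set {set V} * bool} :=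
  [set (tree_edge s g j, b) | j in 'I_m].

Lemma rooted_neq g j : rooted g -> g j != lift ord0 j.
Proof. by move=> [rk /(_ j)]; apply: contraTneq => ->; rewrite ltnn. Qed.

(** Two indices with the same edge would be parents of each other, against the rank. Hence a tree
    has m distinct edges. *)
Lemma tree_edge_inj s g : injective s -> rooted g -> injective (tree_edge s g).
Proof.
move=> sI rg i j e; apply/eqP; apply: contraT => ij.
have [rk rkP] := rg.
have : s (lift ord0 i) \in tree_edge s g j by rewrite -e !inE eqxx.
have : s (lift ord0 j) \in tree_edge s g i by rewrite e !inE eqxx.
rewrite !inE !(inj_eq sI) !(inj_eq lift_inj) (negbTE ij) eq_sym (negbTE ij) /=.
move=> /eqP ji /eqP ij'.
by have := ltn_trans (rkP i) (_ : rk (lift ord0 i) < rk (g i))%N;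
  rewrite -{1}ji {1}ij' rkP ltnn => /(_ isT).
Qed.

(** [nb x] enumerates the neighbours of x by codes in C, so an embedding is determined by the image
    of the root and, for each other vertex, a code relative to its parent; this follows by induction
    on the rank. The successor of #|C| accounts for the [None] of [pick]. *)
Lemma card_tree_embeddings g : rooted g ->
  (#|[set s : {ffun 'I_m.+1 -> V} | injectiveb s & [forall j, tree_edge s g j \in L]]|
    <= #|V| * #|C|.+1 ^ m)%N.
Proof.
move=> rg; set X := [set s : {ffun 'I_m.+1 -> V} | _].
pose code s := (s ord0,
  [ffun j => [pick c | s (lift ord0 j) == nb (s (g j)) c]]).
have codeI : {in X &, injective code}.
  move=> s t; rewrite !inE.
  move=> /andP[/injectiveP sI /forallP sL] /andP[/injectiveP tI /forallP tL].
  case=> e0 /ffunP eC; have [rk rkP] := rg; apply/ffunP => i.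
  have [k] := ubnP (rk i); elim: k i => // k IH i rki.
  have [j iE|-> //] := unliftP ord0 i.
  have est : s (g j) = t (g j).
    by apply: IH; rewrite -ltnS (leq_trans _ rki) // ltnS iE rkP.
  have ex (u : {ffun 'I_m.+1 -> V}) : injective u -> (forall j, tree_edge u g j \in L) ->
      exists c, u (lift ord0 j) = nb (u (g j)) c.
    move=> uI uL; apply: nbP; last by rewrite setUC uL.
    by rewrite (inj_eq uI) rooted_neq.
  have := eC j; rewrite !ffunE est iE; case: pickP => [c /eqP ->|no].
    by case: pickP => // c' /eqP -> [->].
  by have [c] := ex s sI sL; rewrite est => /eqP; rewrite no.
rewrite -(card_in_imset codeI) (leq_trans (max_card _)) //.
by rewrite card_prod card_ffun card_option card_ord.
Qed.

(** The red and blue edges are 2m distinct coordinates. The indicator is kept for the red tree only,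
    since it already limits the labellings; blue edges outside L are bounded crudely by p2. *)
Lemma Pr_trees g1 g2 s : injective s -> rooted g1 -> rooted g2 ->
  Pr pL (fun F => tree_edges true s g1 :|: tree_edges false s g2 \subset F) <=
  [forall j, tree_edge s g1 j \in L]%:R * (p1 * p2) ^+ m.
Proof.
move=> sI r1 r2; rewrite Pr_subset.
have e b g : injective s -> rooted g -> \prod_(x in tree_edges b s g) pL x =
    \prod_(j < m) (if tree_edge s g j \in L then (if b then p1 else p2) else 0).
  move=> _ rg; rewrite big_imset //= => i j _ _ [] /tree_edge_inj; exact.
rewrite (eq_bigl _ _ (fun i => in_setU i _ _)) bigU /=; last first.
  rewrite disjoint_subset; apply/subsetP => _ /imsetP[j _ ->].
  by rewrite inE /=; apply/imsetP => -[].
rewrite !e // exprMn mulrA.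
have [p10 p11] := andP p1_01; have [p20 p21] := andP p2_01.
apply: ler_pM.
- by apply: prodr_ge0 => j _; case: ifP.
- by apply: prodr_ge0 => j _; case: ifP.
- have [al|/forallPn[j /negbTE nj]] := boolP [forall j, tree_edge s g1 j \in L].
    rewrite mul1r (eq_bigr (fun=> p1)) ?prodr_const ?card_ord // => j _.
    by rewrite (forallP al).
  by rewrite mul0r (bigD1 j) //= nj mul0r.
- rewrite -[X in p2 ^+ X]card_ord -prodr_const; apply: ler_prod => j _.
  by case: ifP; rewrite ?p20 ?lexx.
Qed.

Lemma tree_of_cut_connected b (F : {set {set V} * bool}) (S : {set V}) s :
  injective s -> #|S| = m.+1 -> (forall i, s i \in S) ->
  cut_connected (layer b F) S ->
  exists2 g, rooted g & tree_edges b s g \subset F.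
Proof.
move=> sI cS sS /cut_connectedP cF.
have ST : S = [set s i | i in 'I_m.+1].
  apply/esym/eqP; rewrite eqEcard card_imset // card_ord cS leqnn andbT.
  by apply/subsetP => _ /imsetP[i _ ->].
have [A A0 AT|g rg gP] := @rooted_spanning_tree m
    (fun i j => ([set s i; s j], b) \in F).
  have := cF (s @: A); rewrite imset_eq0 A0 ST properEneq imsetS ?subset_predT //.
  have -> : s @: A != s @: 'I_m.+1.
    apply: contraNneq AT => e; rewrite eqEcard subsetT cardsT.
    by rewrite -(card_imset A sI) e (card_imset _ sI) leqnn.
  move=> /(_ isT isT) /edge_betweenP[_ [y [/imsetP[i iA ->]]]].
  rewrite !inE => /andP[yA /imsetP[i' _ yE]].
  rewrite yE in yA * => e; exists i, i'; rewrite iA; split=> //.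
    by apply: contra yA; exact: imset_f.
  by rewrite setUC.
exists g => //; apply/subsetP => _ /imsetP[j _ ->]; exact: gP.
Qed.

(* Each doubly connected set S of size m + 1 is counted (m + 1)! times on the
   right, once for each labelling of S, which pays for the tree count. *)
Lemma Pr_doubly_connected :
  m.+1`!%:R * Pr pL (fun F => [exists S : {set V},
    (#|S| == m.+1) && doubly_connected (dgraph F) S]) <=
  #|V|%:R * (m.+1%:R ^+ 2 * #|C|.+1%:R * (p1 * p2)) ^+ m.
Proof.
have pL01 x : 0 <= pL x <= 1 by exact: edge_prob01.
have p0 : 0 <= p1 * p2 by rewrite mulr_ge0 //; [case/andP: p1_01|case/andP: p2_01].
pose ev s g1 g2 (F : {set {set V} * bool}) :=
  tree_edges true s g1 :|: tree_edges false s g2 \subset F.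
apply: (@le_trans _ _ (\sum_(g1 : {ffun 'I_m -> 'I_m.+1} | `[< rooted g1 >])
    \sum_(g2 : {ffun 'I_m -> 'I_m.+1} | `[< rooted g2 >])
    \sum_(s : {ffun 'I_m.+1 -> V} | injectiveb s) Pr pL (ev s g1 g2))).
  have -> : \sum_(g1 : {ffun 'I_m -> 'I_m.+1} | `[< rooted g1 >])
      \sum_(g2 : {ffun 'I_m -> 'I_m.+1} | `[< rooted g2 >])
      \sum_(s : {ffun 'I_m.+1 -> V} | injectiveb s) Pr pL (ev s g1 g2) =
      Ex pL (fun F => \sum_(g1 : {ffun 'I_m -> 'I_m.+1} | `[< rooted g1 >])
      \sum_(g2 : {ffun 'I_m -> 'I_m.+1} | `[< rooted g2 >])
      \sum_(s : {ffun 'I_m.+1 -> V} | injectiveb s) (ev s g1 g2 F)%:R).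
    by rewrite Ex_sum; apply: eq_bigr => g1 _; rewrite Ex_sum; apply: eq_bigr => g2 _;
      rewrite Ex_sum.
  rewrite /Pr -ExZ.
  apply: le_Ex => // F.
  case: existsP => [[S /andP[/eqP cS /andP[rS bS]]]|_]; last first.
    by rewrite mulr0; do 3!apply: sumr_ge0 => ? _; rewrite ler0n.
  (* The labellings are summed outermost: each of the (m + 1)! labellings of S contributes at least
     one pair of trees. *)
  rewrite mulr1; under eq_bigr do rewrite exchange_big /=.
  rewrite exchange_big /=.
  have cX : #|[set s : {ffun 'I_m.+1 -> V} in ffun_on (mem S) | injectiveb s]|
      = m.+1`!.
    by rewrite card_inj_ffuns_on card_ord cS ffactnn.
  rewrite -cX -sum1_card natr_sum big_mkcond [leRHS]big_mkcond /=.
  apply: ler_sum => s _; rewrite inE.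
  have [sI|_] := boolP (injectiveb s); last by rewrite andbF.
  rewrite andbT; case: ifP => [/ffun_onP sS|_]; last first.
    by do 2!apply: sumr_ge0 => ? _; rewrite ler0n.
  have [g1 r1 e1] := tree_of_cut_connected (injectiveP _ sI) cS sS rS.
  have [g2 r2 e2] := tree_of_cut_connected (injectiveP _ sI) cS sS bS.
  have e12 : 1 <= (ev s g1 g2 F)%:R :> R by rewrite /ev subUset e1 e2.
  apply: (le_trans e12); pose f (h1 h2 : {ffun 'I_m -> 'I_m.+1}) : R := (ev s h1 h2 F)%:R.
  have f0 h1 h2 : 0 <= f h1 h2 by exact: ler0n.
  apply: (@le_trans _ _ (\sum_(g2 | `[< rooted g2 >]) f g1 g2)).
    by apply: (ler_sum_term (f0 g1)); apply/asboolP.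
  apply: (@ler_sum_term _ _ _ (fun h1 => \sum_(g2 | `[< rooted g2 >]) f h1 g2)).
    by move=> h1; apply: sumr_ge0.
  by apply/asboolP.
have bd g1 g2 : rooted g1 -> rooted g2 ->
    \sum_(s : {ffun 'I_m.+1 -> V} | injectiveb s) Pr pL (ev s g1 g2) <=
    (#|V| * #|C|.+1 ^ m)%:R * (p1 * p2) ^+ m.
  move=> r1 r2; apply: (@le_trans _ _ (\sum_(s : {ffun 'I_m.+1 -> V} | injectiveb s)
      [forall j, tree_edge s g1 j \in L]%:R * (p1 * p2) ^+ m)).
    by apply: ler_sum => s /injectiveP sI; exact: Pr_trees.
  rewrite -big_distrl /= ler_wpM2r ?exprn_ge0 //.
  apply: le_trans (_ : _ <= #|[set s : {ffun 'I_m.+1 -> V} | injectiveb s &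
    [forall j, tree_edge s g1 j \in L]]|%:R) _; last first.
    by rewrite ler_nat card_tree_embeddings.
  rewrite -sum1_card natr_sum big_mkcond [leRHS]big_mkcond /=.
  apply: ler_sum => s _; rewrite inE.
  by case: (injectiveb s) => //=; case: [forall j, tree_edge s g1 j \in L].
(* Rootedness is dropped: there are (m + 1)^m maps for each colour. *)
apply: (@le_trans _ _ (\sum_(g1 : {ffun 'I_m -> 'I_m.+1})
    \sum_(g2 : {ffun 'I_m -> 'I_m.+1}) (#|V| * #|C|.+1 ^ m)%:R * (p1 * p2) ^+ m)).
  have ge0 : 0 <= (#|V| * #|C|.+1 ^ m)%:R * (p1 * p2) ^+ m.
    by rewrite mulr_ge0 ?ler0n ?exprn_ge0.
  rewrite big_mkcond; apply: ler_sum => g1 _; case: ifP => [/asboolP r1|_].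
    rewrite big_mkcond; apply: ler_sum => g2 _; case: ifP => [/asboolP r2|_] //.
    exact: bd.
  by apply: sumr_ge0.
rewrite !sumr_const card_ffun !card_ord -mulrnA -[leLHS]mulr_natl.
rewrite !natrM !natrX !exprMn le_eqVlt; apply/orP; left; apply/eqP.
move: (m.+1%:R ^+ m) (#|V|%:R) (#|C|.+1%:R ^+ m) (p1 ^+ m) (p2 ^+ m) => a b c d e.
ring.
Qed.

End TreeCount.

(** * Exploring a clique one vertex at a time *)

(* Conditioning on X: coordinates outside the support of X stay independent. *)
Lemma Ex_freeze (R : realFieldType) (I K : finType) (p : I -> R) (A : {set I})
    (X : {set I} -> K) (B : K -> {set I}) (h : K -> {set I} -> R) :
  supported A X ->
  (forall F, [disjoint A & B (X F)] /\ supported (B (X F)) (h (X F))) ->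
  Ex p (fun F => h (X F) F) = Ex p (fun F => Ex p (h (X F))).
Proof.
move=> XA XB.
have pick_k (f : K -> R) k : f k = \sum_l (k == l)%:R * f l.
  rewrite (bigD1 k) //= eqxx mul1r big1 ?addr0 // => l lk.
  by rewrite eq_sym (negbTE lk) mul0r.
rewrite (eq_Ex _ (fun F => pick_k (fun k => h k F) (X F))).
rewrite [RHS](eq_Ex _ (fun F => pick_k (fun k => Ex p (h k)) (X F))).
rewrite !Ex_sum; apply: eq_bigr => k _.
rewrite [RHS](eq_Ex _ (g := fun F => Ex p (h k) * (X F == k)%:R)); last first.
  by move=> F; rewrite mulrC.
rewrite ExZ mulrC.
(* Independence for [h k] is only given when k is a value of X; for other k both sides vanish. *)
have [[F FX]|noF] := pselect (exists F, X F = k).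
  have [dis sup] := XB F; rewrite FX in dis sup.
  by rewrite (Ex_indep p dis) // => G; rewrite XA.
have X0 F : (X F == k)%:R = 0 :> R.
  by case: eqP => // FX; case: noF; exists F.
have e0 : Ex p (fun F => (X F == k)%:R) = 0.
  by rewrite (eq_Ex _ X0) Ex_cst.
rewrite e0 mul0r -(Ex_cst p 0); apply: eq_Ex => F; by rewrite X0 mul0r.
Qed.

Section BirthChain.
Variables (R : realFieldType) (r : nat -> R) (M : nat).

(* Probability that a pure birth chain started at a, which moves from i to i + 1
   with probability r i, reaches level M within t steps. *)
Fixpoint reach (t a : nat) : R :=
  if (M <= a)%N then 1 else
  if t is t'.+1 then r a * reach t' a.+1 + (1 - r a) * reach t' a else 0.

Lemma reach_top t a : (M <= a)%N -> reach t a = 1.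
Proof. by case: t => [|t] /= ->. Qed.

Lemma reachS t a : reach t.+1 a = r a * reach t a.+1 + (1 - r a) * reach t a.
Proof.
rewrite /=; case: ifP => // Ma.
by rewrite !reach_top ?(leq_trans Ma) //; ring.
Qed.

End BirthChain.

Section Exploration.
Variables (R : realFieldType) (V : finType) (p : {set V} * bool -> R).
Hypothesis p01 : forall i, 0 <= p i <= 1.
Implicit Types (F : {set {set V} * bool}) (X A S : {set V}) (b : bool) (y : V).

(** Removing y from X avoids the degenerate pair [set y; y], a singleton. *)
Definition touches b y X F := [exists x in X :\ y, ([set x; y], b) \in F].

Definition joins y X F := touches true y X F && touches false y X F.

(** The vertices of [s] are offered once each, from the last to the first, so that the induction
    peels off the most recent step. *)
Fixpoint explore (y0 : V) (s : seq V) F : {set V} :=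
  if s is y :: s' then
    let X := explore y0 s' F in if joins y X F then y |: X else X
  else [set y0].

Definition fan b y X := [set ([set x; y], b) | x in X :\ y].

(** Requiring two elements makes the sets of coordinates of two cliques with only one common vertex
    disjoint. *)
Definition inner S : {set {set V} * bool} :=
  [set x : {set V} * bool | (x.1 \subset S) && (1 < #|x.1|)%N].

Lemma touchesP b y X F : touches b y X F = ~~ [disjoint fan b y X & F].
Proof.
apply/exists_inP/pred0Pn => [[x xX xF]|[_ /andP[/imsetP[x xX ->] xF]]].
  by exists ([set x; y], b); apply/andP; split=> //; apply: imset_f.
by exists x.
Qed.

Lemma supported_touches b y X : supported (fan b y X) (touches b y X).
Proof.
move=> F; apply: eq_existsb => x; case xX: (x \in X :\ y) => //=.
by rewrite inE imset_f // andbT.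
Qed.

Lemma supported_joins y X : supported (fan true y X :|: fan false y X) (joins y X).
Proof.
move=> F; rewrite /joins; congr (_ && _).
  exact: (supportedS (subsetUl _ _) (@supported_touches true y X)).
exact: (supportedS (subsetUr _ _) (@supported_touches false y X)).
Qed.

Lemma card_fan b y X : y \notin X -> #|fan b y X| = #|X|.
Proof.
move=> yX; rewrite card_in_imset; first by rewrite [in RHS](cardsD1 y) (negbTE yX).
move=> x x' /setD1P[xy _] _ [] /setP/(_ x).
by rewrite !inE eqxx (negbTE xy) !orbF => /esym/eqP.
Qed.

Lemma fan_inner b y X S : y \notin S -> [disjoint inner S & fan b y X].
Proof.
move=> yS; rewrite disjoint_sym disjoint_subset; apply/subsetP=> _ /imsetP[x _ ->].
by rewrite !inE subUset !sub1set (negbTE yS) andbF.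
Qed.

Lemma explore_sub y0 s F : explore y0 s F \subset [set:: y0 :: s].
Proof.
elim: s => [|y s IH] /=; first by rewrite sub1set !inE eqxx.
have IH' : explore y0 s F \subset [set:: y0 :: y :: s].
  by apply: subset_trans IH _; apply/subsetP => x; rewrite !inE => /orP[->|->];
    rewrite ?orbT.
by case: ifP => // _; rewrite subUset IH' sub1set !inE eqxx orbT.
Qed.

Lemma fan_innerS b y X S : y \in S -> X \subset S -> fan b y X \subset inner S.
Proof.
move=> yS /subsetP XS; apply/subsetP => _ /imsetP[x /setD1P[xy xX] ->].
by rewrite inE /= subUset !sub1set yS XS // cards2 xy.
Qed.

Lemma innerS S S' : S \subset S' -> inner S \subset inner S'.
Proof.
move=> SS; apply/subsetP => x; rewrite !inE => /andP[xS ->].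
by rewrite (subset_trans xS).
Qed.

Lemma supported_explore y0 s : supported (inner [set:: y0 :: s]) (explore y0 s).
Proof.
elim: s => [|y s IH] F //=.
have sub : [set:: y0 :: s] \subset [set:: y0 :: y :: s].
  by apply/subsetP => x; rewrite !inE => /orP[->|->]; rewrite ?orbT.
rewrite -(supportedS (innerS sub) IH); set X := explore y0 s F.
suff -> : joins y X (F :&: inner [set:: y0 :: y :: s]) = joins y X F by [].
apply/esym/(supportedS _ (@supported_joins y X)).
have XS : X \subset [set:: y0 :: y :: s] by apply: subset_trans (explore_sub _ _ _) sub.
by rewrite subUset !fan_innerS // !inE eqxx ?orbT.
Qed.

Lemma Pr_touches b y X q : y \notin X ->
  (forall x, x \in X -> p ([set x; y], b) = q) ->
  Pr p (touches b y X) = 1 - (1 - q) ^+ #|X|.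
Proof.
move=> yX pq; rewrite (eq_Pr _ (touchesP b y X)) Pr_predC Pr_disjoint.
rewrite (eq_bigr (fun=> 1 - q)) ?prodr_const ?card_fan //.
by move=> _ /imsetP[x /setD1P[_ xX] ->]; rewrite pq.
Qed.

Variables (p1 p2 : R).

Definition join_rate a : R := (1 - (1 - p1) ^+ a) * (1 - (1 - p2) ^+ a).

Definition clique_prob S := forall x y, x \in S -> y \in S -> x != y ->
  p ([set x; y], true) = p1 /\ p ([set x; y], false) = p2.

Lemma clique_probS S S' : S \subset S' -> clique_prob S' -> clique_prob S.
Proof. by move=> /subsetP SS h x y /SS xS /SS yS; exact: h. Qed.

Lemma Pr_joins y X : y \notin X -> clique_prob (y |: X) ->
  Pr p (joins y X) = join_rate #|X|.
Proof.
move=> yX cl.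
have clx x : x \in X -> p ([set x; y], true) = p1 /\ p ([set x; y], false) = p2.
  move=> xX; apply: cl; rewrite ?setU11 // ?setU1r //.
  by apply: contraNneq yX => <-.
rewrite (@Pr_indep _ _ p (fan true y X) (fan false y X)).
- rewrite (Pr_touches (q := p1)) // ?(Pr_touches (q := p2)) //.
    by move=> x /clx[].
  by move=> x /clx[].
- rewrite disjoint_subset; apply/subsetP=> _ /imsetP[x _ ->].
  by rewrite inE /=; apply/imsetP => -[].
- exact: supported_touches.
- exact: supported_touches.
Qed.

(** Given the set X explored so far, the edges from y to X have not been read, so y joins with
    conditional probability [join_rate #|X|]: the size is a birth chain. *)
Lemma Ex_explore (phi : nat -> R) y0 y s : uniq (y0 :: y :: s) ->
  clique_prob [set:: y0 :: y :: s] ->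
  Ex p (fun F => phi #|explore y0 (y :: s) F|) =
  Ex p (fun F => let a := #|explore y0 s F| in
    join_rate a * phi a.+1 + (1 - join_rate a) * phi a).
Proof.
move=> us cl.
have yS : y \notin [set:: y0 :: s].
  by move: us; rewrite /= !inE; case: (y == y0) / eqP => [->|];
    rewrite ?eqxx //= => _ /and3P[].
have yX F : y \notin explore y0 s F.
  by apply: contra yS; apply: (subsetP (explore_sub _ _ _)).
pose h X F := phi (if joins y X F then #|X|.+1 else #|X|).
rewrite (eq_Ex _ (g := fun F => h (explore y0 s F) F)); last first.
  by move=> F; rewrite /h /=; case: ifP => // _; rewrite cardsU1 yX.
rewrite (Ex_freeze p (B := fun X => fan true y X :|: fan false y X)
  (h := h) (@supported_explore y0 s)).
- apply: eq_Ex => F /=; set X := explore y0 s F.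
  rewrite -(@Pr_joins y X) ?yX //; last first.
    apply: clique_probS cl; rewrite subUset sub1set !inE eqxx orbT /=.
    apply: subset_trans (explore_sub _ _ _) _.
    by apply/subsetP => x; rewrite !inE => /orP[->|->]; rewrite ?orbT.
  rewrite /Pr mulrBl mul1r addrCA -mulrBr mulrC -ExZ -[X in X + _](Ex_cst p) -ExD.
  by apply: eq_Ex => G; rewrite /h; case: joins => /=; ring.
- move=> F; split.
    rewrite disjoint_sym -setI_eq0 setIUl setU_eq0 !setI_eq0.
    by rewrite ![[disjoint fan _ _ _ & _]]disjoint_sym !fan_inner.
  by move=> G; rewrite /h -supported_joins.
Qed.

(** The martingale of hitting probabilities: t counts the steps left after [s] is exhausted. At t =
    0 the left side is the probability of reaching size M. *)
Lemma Ex_reach M t y0 s : uniq (y0 :: s) -> clique_prob [set:: y0 :: s] ->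
  Ex p (fun F => reach join_rate M t #|explore y0 s F|) =
  reach join_rate M (t + size s) 1.
Proof.
elim: s t => [|y s IH] t us cl.
  by rewrite addn0 /= cards1 Ex_cst.
rewrite Ex_explore //= addnS -addSn -IH.
- by apply: eq_Ex => F; rewrite -reachS.
- by move: us; rewrite /= !inE negb_or -!andbA => /and4P[_ -> _ ->].
- apply: clique_probS cl.
  by apply/subsetP => x; rewrite !inE => /orP[->|->]; rewrite ?orbT.
Qed.

Lemma Pr_explore M y0 s : uniq (y0 :: s) -> clique_prob [set:: y0 :: s] ->
  Pr p (fun F => M <= #|explore y0 s F|)%N = reach join_rate M (size s) 1.
Proof.
move=> us cl; rewrite -(Ex_reach M 0 us cl); apply: eq_Ex => F /=.
by case: ifP.
Qed.

Definition good M y0 s (W : {set V}) F :=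
  let X := explore y0 s F in
  (M <= #|X|)%N && [forall w in W, touches true w X F].

Lemma supported_good M y0 s W :
  supported (inner ([set:: y0 :: s] :|: W)) (good M y0 s W).
Proof.
move=> F; rewrite /good -(supportedS (innerS (subsetUl _ _)) (@supported_explore _ _)).
congr (_ && _); apply: eq_forallb => w; case wW: (w \in W) => //=.
apply: (supportedS _ (@supported_touches _ _ _)).
apply: fan_innerS; first by rewrite inE wW orbT.
by apply: subset_trans (explore_sub _ _ _) (subsetUl _ _).
Qed.

(** Given an explored set X of size at least M, the red edges from W to X are fresh, and each w
    misses X with probability at most (1 - p1)^M; a union bound over W follows. *)
Lemma Pr_good M y0 s (W : {set V}) : uniq (y0 :: s) ->
  [disjoint [set:: y0 :: s] & W] ->
  clique_prob ([set:: y0 :: s] :|: W) -> 0 <= p1 <= 1 ->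
  reach join_rate M (size s) 1 * (1 - #|W|%:R * (1 - p1) ^+ M) <=
  Pr p (good M y0 s W).
Proof.
move=> us dW cl /andP[p10 p11].
rewrite -(Pr_explore M us) //; last exact: clique_probS (subsetUl _ _) cl.
pose h X F : R := ((M <= #|X|)%N && [forall w in W, touches true w X F])%:R.
rewrite {2}/Pr (eq_Ex _ (g := fun F => h (explore y0 s F) F)) //.
have wS w : w \in W -> w \notin [set:: y0 :: s].
  by move=> wW; rewrite (disjointFl dW wW).
rewrite (Ex_freeze p (B := fun X => \bigcup_(w in W) fan true w X)
  (h := h) (@supported_explore y0 s)).
- rewrite /Pr mulrC -ExZ; apply: le_Ex => // F; set X := explore y0 s F.
  have XS : X \subset [set:: y0 :: s] by exact: explore_sub.
  have [MX|MX] := boolP (M <= #|X|)%N; last first.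
    by rewrite mulr0 /h (negbTE MX) /= Ex_cst.
  rewrite mulr1 /h MX /=.
  have /= e := Pr_predC p (fun F => [forall w in W, touches true w X F]).
  rewrite -[leRHS](subKr 1) -{}e lerD2l lerN2.
  rewrite (eq_Pr _ (Q := fun F => [exists w, (w \in W) && ~~ touches true w X F])); last first.
    by move=> G; rewrite negb_forall; apply: eq_existsb => w; rewrite negb_imply.
  apply: le_trans (Pr_exists p01 _ _) _.
  rewrite mulr_natl -sumr_const; apply: ler_sum => w wW.
  rewrite Pr_predC (Pr_touches (q := p1)).
  + rewrite subKr; apply: ler_wiXn2l => //; first by rewrite subr_ge0.
    by rewrite lerBlDr lerDl.
  + by apply: contra (wS w wW); apply: (subsetP XS).
  + move=> x xX; have xS := subsetP XS x xX.
    apply: (cl x w _ _ _).1; rewrite ?(in_setU, xS, wW, orbT) //.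
    by apply: contraNneq (wS w wW) => <-.
- move=> F; split.
    by apply: bigcup_disjoint => w wW; apply: fan_inner; exact: wS.
  move=> G; rewrite /h; congr (_ && _)%:R; apply: eq_forallb => w.
  case wW: (w \in W) => //=.
  by apply: (supportedS _ (@supported_touches _ _ _)); apply: (bigcup_sup w).
Qed.

Lemma sum_exp_card (x : R) S :
  \sum_(A : {set V} | A \subset S) x ^+ #|A| = (1 + x) ^+ #|S|.
Proof.
transitivity (\prod_(i : V) ((if i \in S then x else 0) + 1)).
  rewrite bigA_distr big_mkcond; apply: eq_bigr => A _.
  case: ifP => [/subsetP AS|/negbT/subsetPn[i iA iS]].
    rewrite -prodr_const [LHS]big_mkcond; apply: eq_bigr => i _.
    by case: ifP => // /AS ->.
  by rewrite (bigD1 i) //= iA (negbTE iS) mul0r.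
rewrite -prodr_const [RHS]big_mkcond; apply: eq_bigr => i _.
by case: ifP => _; rewrite ?add0r // addrC.
Qed.

(** Union bound over nonempty A leaving at least k vertices of S outside: the cut is empty with
    probability (1 - q)^(|A| |S - A|), at most x^|A| for x = (1 - q)^k. Summing x^|A| over all
    subsets gives (1 + x)^|S|, and the empty set accounts for the 1 subtracted. *)
Lemma Pr_not_cut_connected b q S k :
  (forall x y, x \in S -> y \in S -> x != y -> p ([set x; y], b) = q) ->
  0 <= q <= 1 -> (k.*2 <= #|S|)%N ->
  Pr p (fun F => ~~ cut_connected (layer b F) S) <=
  (1 + (1 - q) ^+ k) ^+ #|S| - 1.
Proof.
move=> pq /andP[q0 q1] kS.
pose cut A : {set {set V} * bool} :=
  [set ([set u.1; u.2], b) | u in setX A (S :\: A)].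
have cutP A F : edge_between (layer b F) A (S :\: A) = ~~ [disjoint cut A & F].
  apply/edge_betweenP/pred0Pn.
    move=> [x [y [xA yA]]]; rewrite inE => xyF; exists ([set x; y], b).
    by apply/andP; split=> //; apply/imsetP; exists (x, y); rewrite // inE xA yA.
  case=> z /andP[/= /imsetP[[x y]]]; rewrite inE => /andP[/= xA yA] -> xyF.
  by exists x, y; split; rewrite // inE.
have Pcut A : A \subset S -> (k <= #|S :\: A|)%N ->
    Pr p (fun F => ~~ edge_between (layer b F) A (S :\: A)) <= ((1 - q) ^+ k) ^+ #|A|.
  move=> AS kA; rewrite (eq_Pr _ (Q := fun F => [disjoint cut A & F])); last first.
    by move=> F; rewrite cutP negbK.
  rewrite Pr_disjoint (eq_bigr (fun=> 1 - q)); last first.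
    move=> z /imsetP[[x y]]; rewrite !inE /= => /and3P[xA yA yS] ->; rewrite pq //.
      exact: (subsetP AS).
    by apply: contraNneq yA => <-.
  rewrite prodr_const card_in_imset; last first.
    move=> [x y] [x' y']; rewrite !inE /= => /and3P[xA yA _] /and3P[x'A y'A _] [].
    move=> /setP e; have := e x; have := e y; rewrite !inE !eqxx orbT /=.
    move=> /esym/orP[/eqP yx'|/eqP ->]; first by rewrite yx' x'A in yA.
    by move=> /esym/orP[/eqP ->//|/eqP xy']; rewrite -xy' xA in y'A.
  rewrite cardsX -exprM mulnC; apply: ler_wiXn2l.
  - by rewrite subr_ge0.
  - by rewrite lerBlDr lerDl.
  - by rewrite leq_mul2r kA orbT.
apply: le_trans (_ : _ <= Pr p (fun F => [exists A : {set V},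
    [&& A \subset S, A != set0 & k <= #|S :\: A|]%N &&
    ~~ edge_between (layer b F) A (S :\: A)])) _.
  apply: le_Pr => // F /forallPn[A]; rewrite negb_imply -andbA.
  move=> /and3P[AS A0 nA]; have AsS := proper_sub AS; apply/existsP.
  have [kA|kA] := leqP k #|S :\: A|; first by exists A; rewrite AsS A0 nA kA.
  (* Otherwise the roles of the two sides are exchanged: as 2k <= |S|, A itself then has at least k
     elements. *)
  exists (S :\: A); rewrite subsetDl /=.
  have DD : S :\: (S :\: A) = A by rewrite setDDr setDv set0U (setIidPr AsS).
  rewrite DD edge_between_sym nA andbT.
  have cSA := cardsID A S; rewrite (setIidPr AsS) in cSA.
  rewrite -card_gt0; have := proper_card AS; move: kS kA cSA; clear; lia.
apply: le_trans (Pr_exists p01 _ _) _.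
rewrite -sum_exp_card [X in _ <= X - 1](bigD1 set0) ?sub0set //=.
rewrite cards0 expr0 [leRHS]addrC addKr.
rewrite big_mkcond [leRHS]big_mkcond; apply: ler_sum => A _.
have [AS /=|] := boolP (A \subset S); last by [].
case: (A != set0) => //=; case: ifP => kA; first exact: Pcut.
by rewrite !exprn_ge0 // subr_ge0.
Qed.

End Exploration.

(** * Lower bounds for the birth chain *)

Section ChainBounds.
Variables (R : realFieldType) (r : nat -> R) (M : nat).
Hypothesis r01 : forall a, 0 <= r a <= 1.
Implicit Types (t a h k : nat).

Let r0 a : 0 <= r a. Proof. by case/andP: (r01 a). Qed.
Let r1 a : 0 <= 1 - r a. Proof. by rewrite subr_ge0; case/andP: (r01 a). Qed.

Lemma reach_ge0 t a : 0 <= reach r M t a.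
Proof.
elim: t a => [|t IH] a; first by rewrite /=; case: ifP.
by rewrite reachS addr_ge0 ?mulr_ge0.
Qed.

Lemma reach_homo t a : reach r M t a <= reach r M t.+1 a.
Proof.
elim: t a => [|t IH] a.
  rewrite reachS {1}/reach; case: ifP => Ma; last first.
    by rewrite addr_ge0 ?mulr_ge0 ?reach_ge0.
  by rewrite !reach_top ?(leq_trans Ma) // !mulr1 addrC subrK.
by rewrite reachS [leRHS]reachS lerD // ler_wpM2l.
Qed.

Lemma reach_mono t t' a : (t <= t')%N -> reach r M t a <= reach r M t' a.
Proof.
move=> /subnK <-; elim: (t' - t)%N => [|k IH] //.
by rewrite addSn (le_trans IH) ?reach_homo.
Qed.

(** The chain leaves level a within h steps except with probability (1 - r a)^h, and at least t
    steps then remain. *)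
Lemma reach_level t h a :
  (1 - (1 - r a) ^+ h) * reach r M t a.+1 <= reach r M (t + h) a.
Proof.
elim: h => [|h IH]; first by rewrite expr0 subrr mul0r reach_ge0.
rewrite addnS reachS exprS.
have -> : (1 - (1 - r a) * (1 - r a) ^+ h) * reach r M t a.+1 =
  r a * reach r M t a.+1 + (1 - r a) * ((1 - (1 - r a) ^+ h) * reach r M t a.+1).
  by ring.
by rewrite lerD ?ler_wpM2l ?reach_mono ?leq_addr.
Qed.

Lemma reach_levels t h k a :
  (\prod_(a <= i < a + k) (1 - (1 - r i) ^+ h)) * reach r M t (a + k) <=
  reach r M (t + k * h) a.
Proof.
elim: k a => [|k IH] a.
  by rewrite addn0 big_geq // mul1r mul0n addn0.
rewrite big_ltn; last by rewrite addnS ltnS leq_addr.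
rewrite -addSnnS -mulrA mulSnr addnA.
apply: le_trans (reach_level _ _ _); apply: ler_wpM2l; last exact: IH.
by rewrite subr_ge0 exprn_ile1 // lerBlDr lerDl.
Qed.

(* Markov's inequality for the hitting time of M, whose mean is the sum. *)
Lemma reach_markov t a : (forall i, (a <= i < M)%N -> 0 < r i) ->
  t%:R * (1 - reach r M t a) <= \sum_(a <= i < M) (r i)^-1.
Proof.
move=> rpos.
(* This sum of survival probabilities is the mean of the hitting time truncated at t; its terms
   decrease in s. *)
apply: (@le_trans _ _ (\sum_(s < t) (1 - reach r M s a))).
  rewrite mulr_natl -[X in _ *+ X]card_ord -sumr_const; apply: ler_sum => s _.
  by rewrite lerD2l lerN2 reach_mono // ltnW.
elim: t a rpos => [|t IH] a rpos.
  by rewrite big_ord0 big_nat sumr_ge0 // => i ir; rewrite invr_ge0 ltW ?rpos.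
have [Ma|aM] := leqP M a.
  by rewrite big_geq // big1 // => s _; rewrite reach_top // subrr.
rewrite big_ord_recl (eq_bigr (fun s : 'I_t =>
    r a * (1 - reach r M s a.+1) + (1 - r a) * (1 - reach r M s a))); last first.
  by move=> s _; rewrite [X in reach _ _ X]/= reachS; ring.
rewrite big_split -!big_distrr /= leqNgt aM /= subr0.
have IH1 : \sum_(s < t) (1 - reach r M s a.+1) <= \sum_(a.+1 <= i < M) (r i)^-1.
  by apply: IH => i /andP[ai iM]; apply: rpos; rewrite ltnW.
have {IH} := IH a rpos; rewrite big_ltn // => IH0.
have ra : 0 < r a by apply: rpos; rewrite leqnn.
move: IH1 IH0; set S1 := \sum_(s < t) _; set S0 := \sum_(s < t) _.
set T := \sum_(_ <= i < M) _ => IH1 IH0.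
have e1 := ler_wpM2l (r0 a) IH1; have e0 := ler_wpM2l (r1 a) IH0.
have rr : r a * (r a)^-1 = 1 by rewrite divff // gt_eqF.
(* First-step analysis: (r a)^-1 + T is a fixed point of the recursion for the mean hitting time. *)
apply: le_trans (_ : 1 + (r a * T + (1 - r a) * ((r a)^-1 + T)) <= _).
  by rewrite lerD2l lerD.
rewrite le_eqVlt; apply/orP; left; apply/eqP.
have -> : 1 + (r a * T + (1 - r a) * ((r a)^-1 + T)) =
  1 + T + (r a)^-1 - r a * (r a)^-1 by ring.
by rewrite rr; ring.
Qed.

End ChainBounds.

(** * Bounds on the join rate *)

Section Rates.
Variable R : realFieldType.
Implicit Types (p q : R) (a : nat).

Lemma expr_one_sub_le q a : 0 <= q <= 1 -> (1 - q) ^+ a * (1 + a%:R * q) <= 1.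
Proof.
move=> /andP[q0 q1]; elim: a => [|a IH]; first by rewrite expr0 mul0r addr0 mulr1.
apply: le_trans IH; rewrite exprSr -mulrA ler_wpM2l ?exprn_ge0 ?subr_ge0 //.
rewrite -subr_ge0 -natr1.
have -> : 1 + a%:R * q - (1 - q) * (1 + (a%:R + 1) * q) = a%:R * q * q + q * q by ring.
by rewrite addr_ge0 ?mulr_ge0.
Qed.

(** With y = a q, (1 - q)^a <= 1 / (1 + y), so the inverse of its complement is at most (1 + y) /
    y. *)
Lemma inv_one_sub_expr q a : 0 < q <= 1 -> (0 < a)%N ->
  0 < 1 - (1 - q) ^+ a /\ (1 - (1 - q) ^+ a)^-1 <= 1 + (a%:R * q)^-1.
Proof.
move=> /andP[q0 q1] a0; have aq : 0 < a%:R * q by rewrite mulr_gt0 ?ltr0n.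
have := @expr_one_sub_le q a; rewrite (ltW q0) q1 => /(_ isT).
set x := (1 - q) ^+ a; set y := a%:R * q in aq * => xy.
have y1 : 0 < 1 + y by rewrite addr_gt0.
have x1 : x < 1.
  rewrite ltNge; apply/negP => x1.
  have := le_trans (ler_wpM2r (ltW y1) x1) xy; rewrite mul1r -subr_ge0.
  by rewrite opprD addNKr oppr_ge0 leNgt aq.
split; first by rewrite subr_gt0.
rewrite -[leLHS]mul1r ler_pdivrMr ?subr_gt0 // -subr_ge0.
have -> : (1 + y^-1) * (1 - x) - 1 = y^-1 * (1 - x * (1 + y)).
  by field; rewrite gt_eqF.
by rewrite mulr_ge0 ?invr_ge0 ?subr_ge0 // ltW.
Qed.

Lemma join_rate01 (p1 p2 : R) a : 0 <= p1 <= 1 -> 0 <= p2 <= 1 ->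
  0 <= join_rate p1 p2 a <= 1.
Proof.
have aux q : 0 <= q <= 1 -> 0 <= 1 - (1 - q) ^+ a <= 1.
  move=> /andP[q0 q1]; have h : 0 <= 1 - q by rewrite subr_ge0.
  rewrite subr_ge0 exprn_ile1 ?lerBlDr ?lerDl //=.
  by rewrite exprn_ge0.
move=> /aux/andP[x0 x1] /aux/andP[y0 y1].
by rewrite /join_rate mulr_ge0 // mulr_ile1.
Qed.

Lemma inv_join_rate (p1 p2 : R) a : 0 < p1 <= 1 -> 0 < p2 <= 1 -> (0 < a)%N ->
  0 < join_rate p1 p2 a /\
  (join_rate p1 p2 a)^-1 <= (1 + (a%:R * p1)^-1) * (1 + (a%:R * p2)^-1).
Proof.
move=> h1 h2 a0; have [g1 l1] := inv_one_sub_expr h1 a0.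
have [g2 l2] := inv_one_sub_expr h2 a0; rewrite /join_rate; split.
  by rewrite mulr_gt0.
by rewrite invfM ler_pM // invr_ge0 ltW.
Qed.

End Rates.

(** * The line graph of the complete graph *)

Section LineGraph.
Variables (n : nat) (v0 : Lvertex n).
Implicit Types (i j g : 'I_n) (v : Lvertex n).

(* The default v0 is only reached for i = j. *)
Definition pair i j : Lvertex n := insubd v0 [set i; j].

Lemma val_pair i j : i != j -> val (pair i j) = [set i; j].
Proof. by move=> ij; rewrite insubdK // -topredE /= cards2 ij. Qed.

Lemma pairC i j : pair i j = pair j i.
Proof. by rewrite /pair setUC. Qed.

Lemma in_pair i j k : i != j -> (k \in val (pair i j)) = (k == i) || (k == j).
Proof. by move=> ij; rewrite val_pair // !inE. Qed.

Lemma pairP v i : i \in val v -> exists2 j, i != j & v = pair i j.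
Proof.
move=> iv; have /cards2P[a [b [ab vE]]] := valP v.
move: iv; rewrite vE !inE => /orP[]/eqP->.
  by exists b => //; apply: val_inj; rewrite val_pair.
by exists a; rewrite 1?eq_sym // pairC; apply: val_inj; rewrite val_pair.
Qed.

Lemma pair_surj v : exists i j, i != j /\ v = pair i j.
Proof.
have /cards2P[a [b [ab vE]]] := valP v.
by exists a, b; split=> //; apply: val_inj; rewrite val_pair.
Qed.

Lemma pair_inj i : {in [pred j | j != i] &, injective (pair i)}.
Proof.
move=> j k; rewrite !inE => ji ki /(congr1 val); rewrite !val_pair 1?eq_sym //.
by move=> /setP/(_ j); rewrite !inE eqxx orbT (negbTE ji) /= => /esym/eqP.
Qed.

Definition star i : {set Lvertex n} := [set v : Lvertex n | i \in val v].

Lemma pair_star i j : i != j -> pair i j \in star i.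
Proof. by move=> ij; rewrite inE in_pair ?eqxx. Qed.

Lemma star_Ledge i x y : x \in star i -> y \in star i -> x != y ->
  [set x; y] \in Ledge n.
Proof.
rewrite !inE => ix iy xy; apply/existsP; exists x; apply/existsP; exists y.
by rewrite xy eqxx andbT; apply/set0Pn; exists i; rewrite inE ix.
Qed.

(** A neighbour of x keeps one of the two elements of x, selected by the Boolean read as an index 0
    or 1, and has a second element c.2: there are 2n codes. *)
Definition line_nb (x : Lvertex n) (c : bool * 'I_n) : Lvertex n :=
  pair (nth c.2 (enum (val x)) c.1) c.2.

Lemma line_nbP x y : x != y -> [set x; y] \in Ledge n ->
  exists c, y = line_nb x c.
Proof.
move=> xy; rewrite inE => /existsP[a /existsP[b /and3P[ab abI /eqP E]]].
have [k] : exists k, k \in val x :&: val y.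
  have xab : x \in [set a; b] by rewrite -E !inE eqxx.
  have yab : y \in [set a; b] by rewrite -E !inE eqxx orbT.
  case/set0Pn: abI => k kab; exists k; move: xab yab kab xy.
  rewrite !inE => /orP[]/eqP-> /orP[]/eqP->; rewrite ?eqxx //.
  by rewrite andbC.
rewrite inE => /andP[kx /pairP[l kl yE]].
have kE : k \in enum (val x) by rewrite mem_enum.
have lt2 : (index k (enum (val x)) < 2)%N.
  have ltc : (index k (enum (val x)) < #|val x|)%N by rewrite cardE index_mem.
  by apply: leq_trans ltc _; rewrite (eqP (valP x)).
exists ((index k (enum (val x)) == 1)%N, l); rewrite /line_nb /=.
suff -> : nat_of_bool (index k (enum (val x)) == 1)%N = index k (enum (val x)).
  by rewrite nth_index.
by case: (index _ _) lt2 => [|[]].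
Qed.

End LineGraph.

(** * From good stars to percolation *)

Lemma touches_sub (V : finType) b (y : V) (X C : {set V}) F : X \subset C ->
  touches b y X F -> exists2 x, x \in C & [set x; y] \in layer b F.
Proof.
move=> /subsetP XC /exists_inP[x /setD1P[_ xX] xF].
by exists x; rewrite ?inE //; exact: XC.
Qed.

Lemma explore_absorbing (V : finType) F (C : {set V}) y0 s :
  absorbing (dgraph F) C -> y0 \in C -> explore y0 s F \subset C.
Proof.
move=> aC y0C; elim: s => [|y s IH] /=; first by rewrite sub1set.
case: ifP => // /andP[tr tb]; rewrite subUset IH sub1set andbT.
by apply: aC; [exact: touches_sub tr|exact: touches_sub tb].
Qed.

Lemma set_map_seqP (T V : finType) (f : T -> V) (s : seq T) v :
  v \in [set:: map f s] -> exists2 j, j \in s & v = f j.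
Proof. by rewrite inE => /mapP. Qed.

Section Star.
Variables (n : nat) (v0 : Lvertex n) (u0 : 'I_n) (us : seq 'I_n) (M : nat).
Hypothesis us_uniq : uniq (u0 :: us).
Implicit Types (i j g : 'I_n) (F : {set {set Lvertex n} * bool}).

Local Notation pair := (pair v0).

(** The half W of the ground set, which supplies the centres of good stars and the endpoints of
    leaves; [u0 :: us] lists the half U. *)
Definition unexplored : {set 'I_n} := ~: [set:: u0 :: us].

Lemma in_unexplored j : (j \in unexplored) = (j \notin u0 :: us).
Proof. by rewrite !inE. Qed.

Definition leaves i : {set Lvertex n} := [set pair i w | w in unexplored :\ i].

Definition good_star g F :=
  good M (pair g u0) (map (pair g) us) (leaves g) F.

Lemma pair_leaves i w : i != w -> w \in unexplored -> pair i w \in leaves i.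
Proof.
by move=> iw wW; apply: imset_f; rewrite in_setD1 eq_sym iw wW.
Qed.

Lemma leavesP i v : v \in leaves i ->
  exists w, [/\ w \in unexplored, i != w & v = pair i w].
Proof. by move=> /imsetP[w /setD1P[wi wW] ->]; exists w; rewrite eq_sym. Qed.

Lemma percolates_of_good_stars F :
  (exists w, w \in unexplored) ->
  (forall i, cut_connected (layer false F) (leaves i)) ->
  (forall i j, i != j -> j \notin unexplored ->
     joins (pair i j) (leaves i) F) ->
  (forall i j, i != j -> exists g, [/\ g \in unexplored, g != i, g != j,
     good_star g F & ([set pair j g; pair i j], true) \in F]) ->
  percolates (dgraph F).
Proof.
move=> [w0 w0W] conn att link; apply: percolates_of_absorbing => P.
move=> /and3P[/eqP cP tP _] absP.
have u0W : u0 \notin unexplored by rewrite !inE eqxx.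
(* The cluster of {g, u0} contains the explored set, to which all leaves of g are red-adjacent. A
   blue edge from {g, u0} brings in a first leaf, blue connectivity the other leaves, and [att] the
   remaining pairs. *)
have full g : g \in unexplored -> good_star g F ->
    exists2 C, C \in P & forall j, g != j -> pair g j \in C.
  move=> gW /andP[_ /forall_inP red_W].
  have gu0 : g != u0 by apply: contraNneq u0W => <-.
  have : pair g u0 \in cover P by rewrite cP inE.
  case/bigcupP=> C CP u0C; exists C => //; have aC := absP C CP.
  have XC := explore_absorbing (map (pair g) us) aC u0C.
  have redC v : v \in leaves g -> exists2 x, x \in C & [set x; v] \in layer true F.
    by move=> /red_W; exact: touches_sub.
  have WC : leaves g \subset C.
    apply: (absorbing_cut_connected aC (conn g)) => [v /redC //|].
    have /andP[_ /exists_inP[v /setD1P[_ vW] vb]] := att g u0 gu0 u0W.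
    apply/set0Pn; exists v; rewrite inE vW /=; apply: aC; first exact: redC.
    by exists (pair g u0) => //; rewrite inE setUC.
  move=> j gj; have [jW|jW] := boolP (j \in unexplored).
    by apply: (subsetP WC); exact: pair_leaves.
  have /andP[tr tb] := att g j gj jW.
  by apply: aC; apply: touches_sub WC _.
have w0u0 : u0 != w0 by apply: contraNneq u0W => ->.
have [g0 [g0W _ _ good0 _]] := link u0 w0 w0u0.
have [C CP g0C] := full g0 g0W good0.
have aC := absP C CP.
(* The stars of g0 and g share the vertex {g0, g}, so their clusters coincide. *)
have goodC g j : g \in unexplored -> good_star g F -> g != j -> pair g j \in C.
  move=> gW gg gj; have [D DP gD] := full g gW gg.
  have [e|g0g] := eqVneq g0 g; first by rewrite -e g0C // e.
  have gg0D : pair g0 g \in D by rewrite pairC gD // eq_sym.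
  rewrite -(def_pblock tP CP (g0C g g0g)) (def_pblock tP DP gg0D); exact: gD.
(* A leaf {i, w} is red-adjacent to {w, g} for some good g, and {i, g} is a leaf of i already in C,
   so blue connectivity applies. *)
have leavesC i : leaves i \subset C.
  apply: (absorbing_cut_connected aC (conn i)) => [v|].
    move=> /leavesP[w [_ iw ->]] _.
    have [g [gW gi gw gg e]] := link i w iw.
    by exists (pair w g); rewrite ?inE // pairC goodC.
  have [j ij] : exists j, i != j.
    by have [->|] := eqVneq i u0; [exists w0|exists u0].
  have [g [gW gi gw gg e]] := link i j ij; apply/set0Pn; exists (pair i g).
  by rewrite inE pair_leaves 1?eq_sym //= pairC goodC.
exists C => //; apply/setP => v; rewrite inE.
have [i [j [ij ->]]] := pair_surj v0 v.
have [jW|jW] := boolP (j \in unexplored).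
  by apply: (subsetP (leavesC i)); exact: pair_leaves.
have /andP[tr tb] := att i j ij jW.
by apply: aC; apply: touches_sub (leavesC i) _.
Qed.

Section Probability.
Variables (R : realFieldType) (p1 p2 : R).
Hypotheses (p1_01 : 0 <= p1 <= 1) (p2_01 : 0 <= p2 <= 1).

Let p := edge_prob p1 p2 (Ledge n).

Let p01 x : 0 <= p x <= 1.
Proof. exact: edge_prob01. Qed.

Lemma clique_star g : clique_prob p p1 p2 (star g).
Proof.
by move=> x y xg yg xy; rewrite /p /edge_prob /= (star_Ledge xg yg xy).
Qed.

Lemma card_leaves i : (#|unexplored|.-1 <= #|leaves i|)%N.
Proof.
rewrite card_in_imset => [|j k /setD1P[ji _] /setD1P[ki _]]; last exact: pair_inj.
rewrite (cardsD1 i unexplored); case: (i \in unexplored) => /=;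
  by rewrite ?add1n ?add0n ?leq_pred.
Qed.

Lemma card_leaves_le i : (#|leaves i| <= n)%N.
Proof. by rewrite (leq_trans (leq_imset_card _ _)) // (leq_trans (max_card _)) ?card_ord. Qed.

Lemma leaves_star i : leaves i \subset star i.
Proof. by apply/subsetP => v /leavesP[w [_ iw ->]]; exact: pair_star. Qed.

Lemma good_star_clique g : g \in unexplored ->
  [set:: pair g u0 :: map (pair g) us] :|: leaves g \subset star g.
Proof.
move=> gW; rewrite subUset leaves_star andbT; apply/subsetP => v.
move=> /(@set_map_seqP _ _ (pair g) (u0 :: us) v)[j ju ->]; apply: pair_star.
by apply: contraTneq gW => ->; rewrite in_unexplored ju.
Qed.

Lemma supported_good_star g : g \in unexplored ->
  supported (inner (star g)) (good_star g).
Proof.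
by move=> gW; apply: (supportedS (innerS (good_star_clique gW))) (@supported_good _ _ _ _ _).
Qed.

Lemma Pr_good_star g : g \in unexplored ->
  reach (join_rate p1 p2) M (size us) 1 * (1 - n%:R * (1 - p1) ^+ M) <=
  Pr p (good_star g).
Proof.
move=> gW; have [p10 p11] := andP p1_01.
have gu j : j \in u0 :: us -> j != g.
  by move=> ju; apply: contraTneq gW => <-; rewrite in_unexplored ju.
have r0 : 0 <= reach (join_rate p1 p2) M (size us) 1.
  by apply: reach_ge0 => a; exact: join_rate01.
have us' : uniq (pair g u0 :: map (pair g) us).
  rewrite -[X in uniq X]/(map (pair g) (u0 :: us)) map_inj_in_uniq // => j k /gu jg /gu kg.
  exact: pair_inj.
have dis : [disjoint [set:: pair g u0 :: map (pair g) us] & leaves g].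
  rewrite disjoint_subset; apply/subsetP => v.
  move=> /(@set_map_seqP _ _ (pair g) (u0 :: us) v)[j ju ->]; rewrite inE.
  apply/negP => /leavesP[w [wW gw /pair_inj e]].
  have jw : j = w by apply: e; rewrite inE; [exact: gu|rewrite eq_sym].
  by move: wW; rewrite -jw in_unexplored ju.
have h := Pr_good p01 M us' dis
  (clique_probS (good_star_clique gW) (@clique_star g)) p1_01.
rewrite size_map in h; apply: le_trans h; apply: ler_wpM2l => //.
rewrite lerD2l lerN2 ler_wpM2r ?exprn_ge0 ?subr_ge0 //.
by rewrite ler_nat card_leaves_le.
Qed.

Lemma star_inner_disjoint g g' : g != g' ->
  [disjoint inner (star g) & inner (star g')].
Proof.
move=> gg'; rewrite disjoint_subset; apply/subsetP => -[e b].
rewrite [_ \in inner (star g)]inE => /andP[/= eg e2].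
rewrite inE /=; apply: contraL e2; rewrite inE /= => /andP[eg' _].
rewrite -leqNgt; suff /subset_leq_card h : e \subset [set pair g g'].
  by apply: leq_trans h _; rewrite cards1.
apply/subsetP => v ve.
have := subsetP eg v ve; have := subsetP eg' v ve; rewrite !inE => g'v gv.
apply/eqP; have [j gj vE] := pairP v0 gv; rewrite vE in g'v *.
by move: g'v; rewrite in_pair // => /orP[]/eqP e'; [rewrite e' eqxx in gg'|rewrite e'].
Qed.

(** For g other than i and j, the edge between {j, g} and {i, j} lies in the star of j and in no
    star explored here. The events for different g thus read disjoint coordinates, and each has
    probability at least q p1. *)
Lemma Pr_no_link i j (q : R) : i != j -> 0 <= q ->
  (forall g, g \in unexplored -> q <= Pr p (good_star g)) ->
  Pr p (fun F => ~~ [exists g, [&& g \in unexplored, g != i, g != j,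
     good_star g F & ([set pair j g; pair i j], true) \in F]]) <=
  (1 - q * p1) ^+ (#|unexplored| - 2).
Proof.
move=> ij q0 qP; have [p10 p11] := andP p1_01.
pose D := unexplored :\ i :\ j.
pose lk g : {set {set Lvertex n} * bool} := [set ([set pair j g; pair i j], true)].
pose B g := inner (star g) :|: lk g.
pose Q g F := good_star g F && (lk g \subset F).
have notin_star g : g != i -> g != j -> pair i j \notin star g.
  by move=> gi gj; rewrite inE in_pair // (negbTE gi) (negbTE gj).
have lk_inner g g' : g != i -> g != j -> [disjoint inner (star g) & lk g'].
  move=> gi gj; rewrite disjoint_sym disjoints1 inE /= subUset !sub1set.
  by rewrite (negbTE (notin_star g gi gj)) andbF.
have Qsup g : g \in D -> supported (B g) (Q g).
  rewrite !in_setD1 => /and3P[gj gi gW] F; rewrite /Q.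
  rewrite -(supportedS (subsetUl _ _) (supported_good_star gW)).
  by rewrite subsetI subsetUr andbT.
have PrQ g : g \in D -> q * p1 <= Pr p (Q g).
  rewrite !in_setD1 => /and3P[gj gi gW].
  rewrite (Pr_indep p (lk_inner g g gi gj) (supported_good_star gW)); last first.
    by move=> F; rewrite subsetI subxx andbT.
  rewrite Pr_subset big_set1 /p /edge_prob /= (@star_Ledge _ j).
  - by rewrite ler_wpM2r ?qP.
  - by rewrite pair_star // eq_sym.
  - by rewrite pairC pair_star // eq_sym.
  - by apply: contraNneq (notin_star g gi gj) => <-; rewrite pairC pair_star.
have disB : {in enum D &, forall g g', g != g' -> [disjoint B g & B g']}.
  move=> g g'; rewrite !mem_enum !in_setD1 => /and3P[gj gi _] /and3P[g'j g'i _] gg'.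
  rewrite -setI_eq0 setIUl !setIUr !setU_eq0 !setI_eq0 star_inner_disjoint //.
  rewrite lk_inner // [[disjoint lk g & _]]disjoint_sym lk_inner //=.
  rewrite disjoints1 in_set1 xpair_eqE eqxx andbT; apply/eqP => /setP e.
  have := e (pair j g); rewrite !inE eqxx /= => /esym/orP[]/eqP.
    by move=> /pair_inj; rewrite !inE => /(_ gj g'j) e'; rewrite e' eqxx in gg'.
  by rewrite [RHS]pairC => /pair_inj; rewrite !inE => /(_ gj ij) e'; rewrite e' eqxx in gi.
pose Q' g F := (g \in D) ==> ~~ Q g F.
have Q'sup g : supported (B g) (Q' g).
  by move=> F; rewrite /Q'; case gD: (g \in D) => //=; rewrite -Qsup.
rewrite (eq_Pr _ (Q := fun F => all (Q'^~ F) (enum D))); last first.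
  move=> F; apply/existsPn/allP => h g.
    rewrite mem_enum => gD; rewrite /Q' gD /=; have := h g; apply: contra.
    move: gD; rewrite !in_setD1 => /and3P[-> -> ->] /andP[->].
    by rewrite sub1set.
  apply/negP => /and5P[gW gi gj gg lkF].
  have gD : g \in D by rewrite !in_setD1 gi gj.
  by have := h g; rewrite mem_enum gD /Q' gD /Q gg sub1set lkF => /(_ isT).
rewrite (Pr_all_indep p (enum_uniq _) Q'sup disB).
rewrite big_enum /=.
apply: (@le_trans _ _ (\prod_(g in D) (1 - q * p1))).
  apply: ler_prod => g gD; rewrite Pr_ge0 //=.
  rewrite (eq_Pr _ (Q := fun F => ~~ Q g F)); last by move=> F; rewrite /Q' gD.
  by rewrite Pr_predC lerD2l lerN2 PrQ.
have cD : (#|unexplored| - 2 <= #|D|)%N.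
  rewrite (cardsD1 i) (cardsD1 j (unexplored :\ i)) -/D leq_subLR addnA leq_add2r.
  by rewrite -[2%N]/(1 + 1)%N leq_add // leq_b1.
(* A member g of D yields q p1 <= 1, needed to compare powers; for empty D the exponent is 0. *)
have [D0|[g gD]] := set_0Vmem D.
  have -> : (#|unexplored| - 2 = 0)%N.
    by apply/eqP; rewrite -leqn0 (leq_trans cD) // D0 cards0.
  by rewrite D0 big_set0 expr0.
have qp1 : 0 <= 1 - q * p1.
  by rewrite subr_ge0 (le_trans (PrQ g gD)) // Pr_le1.
rewrite prodr_const; apply: ler_wiXn2l => //.
by rewrite lerBlDr lerDl mulr_ge0.
Qed.

Lemma Pr_not_joins i j : i != j -> j \notin unexplored ->
  Pr p (fun F => ~~ joins (pair i j) (leaves i) F) <=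
  (1 - p1) ^+ #|unexplored|.-1 + (1 - p2) ^+ #|unexplored|.-1.
Proof.
move=> ij jW.
have nin : pair i j \notin leaves i.
  apply/negP => /leavesP[w [wW iw /pair_inj e]].
  by move: jW; rewrite (e _ _) ?wW // inE eq_sym.
have cl x : x \in leaves i ->
    p ([set x; pair i j], true) = p1 /\ p ([set x; pair i j], false) = p2.
  move=> xi; apply: (@clique_star i); rewrite ?pair_star //.
    exact: (subsetP (leaves_star i)).
  by apply: contraNneq nin => <-.
have one (q : R) b : 0 <= q <= 1 ->
    (forall x, x \in leaves i -> p ([set x; pair i j], b) = q) ->
    Pr p (fun F => ~~ touches b (pair i j) (leaves i) F) <= (1 - q) ^+ #|unexplored|.-1.
  move=> /andP[q0 q1] pq; rewrite Pr_predC (Pr_touches nin pq) subKr.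
  apply: ler_wiXn2l; rewrite ?subr_ge0 ?lerBlDr ?lerDl //; exact: card_leaves.
rewrite (eq_Pr _ (fun F => negb_and _ _)); apply: le_trans (Pr_orb p01 _ _) _.
by apply: lerD; apply: one => // x /cl[].
Qed.

(** Union bound over three failures: the leaves of some i are not blue-connected, some {i, j} with j
    in U is not joined to the leaves of i, or some pair has no link to a good star. *)
Lemma Pr_not_percolates (q : R) k : 0 <= q -> (0 < #|unexplored|)%N ->
  (k.*2 <= #|unexplored|.-1)%N ->
  (forall g, g \in unexplored -> q <= Pr p (good_star g)) ->
  Pr p (fun F => ~~ `[< percolates (dgraph F) >]) <=
  n%:R * ((1 + (1 - p2) ^+ k) ^+ n - 1) +
  n%:R ^+ 2 * ((1 - p1) ^+ #|unexplored|.-1 + (1 - p2) ^+ #|unexplored|.-1) +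
  n%:R ^+ 2 * (1 - q * p1) ^+ (#|unexplored| - 2).
Proof.
move=> q0 W0 kW qP; have [p10 p11] := andP p1_01; have [p20 p21] := andP p2_01.
have [w wW] : exists w, w \in unexplored by exact/card_gt0P.
pose E1 F := [exists i : 'I_n, true && ~~ cut_connected (layer false F) (leaves i)].
pose E2 F := [exists u : 'I_n * 'I_n, ((u.1 != u.2) && (u.2 \notin unexplored)) &&
  ~~ joins (pair u.1 u.2) (leaves u.1) F].
pose E3 F := [exists u : 'I_n * 'I_n, (u.1 != u.2) &&
  ~~ [exists g, [&& g \in unexplored, g != u.1, g != u.2,
     good_star g F & ([set pair u.2 g; pair u.1 u.2], true) \in F]]].
apply: le_trans (_ : Pr p (fun F => (E1 F || E2 F) || E3 F) <= _).
  apply: le_Pr => // F; apply: contraR; rewrite !negb_or -!andbA.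
  move=> /and3P[/existsPn n1 /existsPn n2 /existsPn n3]; apply/asboolP.
  apply: percolates_of_good_stars.
  - by exists w.
  - by move=> i; have := n1 i; rewrite negbK.
  - by move=> i j ij jW; have := n2 (i, j); rewrite /= ij jW negbK.
  - move=> i j ij; have := n3 (i, j); rewrite /= ij /= negbK.
    by move=> /existsP[g /and5P[? ? ? ? ?]]; exists g.
have sum2 (D : pred ('I_n * 'I_n)) (x : R) : 0 <= x ->
    \sum_(u | D u) x <= n%:R ^+ 2 * x.
  move=> x0; rewrite sumr_const -[leLHS]mulr_natl ler_wpM2r // -natrX ler_nat.
  by rewrite (leq_trans (max_card _)) // card_prod card_ord.
apply: le_trans (Pr_orb p01 _ _) _; apply: lerD.
  apply: le_trans (Pr_orb p01 _ _) _; apply: lerD.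
    apply: le_trans (Pr_exists p01 _ _) _.
    rewrite mulr_natl -[X in _ *+ X]card_ord -sumr_const; apply: ler_sum => i _.
    apply: (@le_trans _ _ ((1 + (1 - p2) ^+ k) ^+ #|leaves i| - 1)).
      apply: (Pr_not_cut_connected p01 _ p2_01); last exact: leq_trans (card_leaves i).
      move=> x y xi yi xy; apply: (@clique_star i _ _ _ _ xy).2;
      exact: (subsetP (leaves_star i)).
    rewrite lerD2r ler_weXn2l ?card_leaves_le // lerDl exprn_ge0 // subr_ge0 //.
  apply: le_trans (Pr_exists p01 _ _) _; apply: le_trans (sum2 _ _ _).
    apply: ler_sum => -[i j] /andP[/= ij jW]; exact: Pr_not_joins.
  by rewrite addr_ge0 // exprn_ge0 // subr_ge0.
apply: le_trans (Pr_exists p01 _ _) _; apply: le_trans (sum2 _ _ _).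
  by apply: ler_sum => -[i j] /= ij; exact: Pr_no_link.
rewrite exprn_ge0 // subr_ge0 mulr_ile1 //.
by rewrite (le_trans (qP w wW)) // Pr_le1.
Qed.

End Probability.
End Star.

Lemma card_Lvertex n : #|Lvertex n| = 'C(n, 2).
Proof.
by rewrite card_sig -[n in RHS]card_ord -card_draws; apply: eq_card => A; rewrite !inE.
Qed.

Lemma card_Lvertex_le n : (#|Lvertex n| <= n ^ 2)%N.
Proof.
rewrite card_Lvertex bin2 leq_half_double -addnn -mulnn.
by rewrite (leq_trans (_ : _ <= n * n)%N) ?leq_mul2l ?leq_pred ?orbT // leqW // leq_addr.
Qed.

Lemma card_Lvertex_ge n : (10 < n)%N -> (n * 5 <= #|Lvertex n|)%N.
Proof.
rewrite card_Lvertex bin2 geq_half_double -muln2 -mulnA leq_mul2l.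
by case: n => // n; rewrite ltnS => ->; rewrite orbT.
Qed.

From mathcomp Require Import all_classical all_reals all_analysis.

(** * The subcritical regime *)

Section Elementary.
Variable R : realType.
Implicit Types x y : R.

Lemma natr_above x : 0 <= x -> exists k : nat, x <= k%:R <= x + 1.
Proof.
move=> x0; have /andP[h1 h2] := truncn_itv x0.
by exists (Num.truncn x).+1; rewrite ltW //= -natr1 lerD2r.
Qed.

(** From exp(-1/2) >= 1/2. *)
Lemma expR1_le4 : expR 1 <= 4 :> R.
Proof.
have -> : 1 = 2%:R * (1 / 2) :> R by lra.
rewrite expRM_natl.
have h := @expR_ge1Dx R (- (1 / 2)).
have e0 := @expR_gt0 R (1 / 2).
have : expR (1 / 2) * expR (- (1 / 2)) = 1 :> R by exact: expRxMexpNx_1.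
by move: h e0; set a := expR (1 / 2); set b := expR _ => h e0 ab; nra.
Qed.

(** One term of the exponential series at k. *)
Lemma expn_le_expR_fact k : k%:R ^+ k <= expR k%:R * k`!%:R :> R.
Proof.
case: k => [|k]; first by rewrite expr0 expR0 mul1r.
rewrite -ler_pdivrMr ?ltr0n ?fact_gt0 //.
apply: le_trans (@expR_ge1Dxn R k.+1%:R k (ler0n _ _)).
by rewrite lerDr.
Qed.

Lemma subr_expr_le q x k : 0 <= q <= 1 -> x <= q * k%:R -> (1 - q) ^+ k <= expR (- x).
Proof.
move=> /andP[q0 q1] xq; apply: (@le_trans _ _ (expR (- q) ^+ k)).
  by apply: lerXn2r; rewrite ?nnegrE ?expR_ge0 ?subr_ge0 // expR_ge1Dx.
by rewrite -expRM_natl ler_expR mulrN lerN2 mulrC.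
Qed.

End Elementary.

Section Subcritical.
Variables (R : realType) (n : nat) (p1 p2 : R).
Hypotheses (p1_01 : 0 <= p1 <= 1) (p2_01 : 0 <= p2 <= 1).

Local Notation l := (ln (n%:R : R)).

Let p := edge_prob p1 p2 (Ledge n).

(** With k = m + 1 and 2n + 1 <= 3n, the base of the tree bound is at most k times 3k / (1000 ln n),
    hence at most k e^-2. One factor e^-m is spent on k^m e^-m <= e k!, the other remains. *)
Lemma Pr_doubly_connected_line (v0 : Lvertex n) m :
  m.+1%:R <= 10 * l -> 1 <= l -> p1 * p2 <= 1 / (1000 * n%:R * l) ->
  Pr p (fun F => [exists S : {set Lvertex n},
    (#|S| == m.+1) && doubly_connected (dgraph F) S]) <=
  n%:R ^+ 2 * expR 1 * expR (- m%:R).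
Proof.
move=> ml l1 pp; set P := Pr _ _.
have n0 : 0 < n%:R :> R.
  by rewrite ltNge; apply/negP => h; have := ln_le0 (le_trans h ler01); lra.
have := @Pr_doubly_connected R _ (Ledge n) m p1 p2 _ (line_nb v0) p1_01 p2_01 (@line_nbP n v0).
rewrite -/p -/P card_prod card_bool card_ord.
set k : R := m.+1%:R; set x := k ^+ 2 * _ * _ => main.
have k1 : 1 <= k by rewrite /k ler1n.
have pp0 : 0 <= p1 * p2 by rewrite mulr_ge0 //; [case/andP: p1_01|case/andP: p2_01].
have x_le : x <= k * (3 * k / (1000 * l)).
  rewrite /x expr2 -!mulrA; apply: ler_wpM2l; first by lra.
  have -> : 3 * (k / (1000 * l)) = k * ((3 * n%:R) * (1 / (1000 * n%:R * l))).
    by field; rewrite !gt_eqF //; lra.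
  apply: ler_wpM2l; first by lra.
  apply: ler_pM => //.
  rewrite -natr1 natrM; have : 1 <= n%:R :> R by rewrite ler1n -(ltr0n R).
  lra.
have x0 : 0 <= x.
  by apply: mulr_ge0 => //; apply: mulr_ge0 => //; apply: exprn_ge0; lra.
have y_le : 3 * k / (1000 * l) <= expR (-1) * expR (-1).
  have e4 := expR1_le4 R.
  have ee : expR 1 * expR (-1) = 1 :> R by exact: expRxMexpNx_1.
  have e0 := @expR_gt0 R 1; have e0' := @expR_gt0 R (-1).
  have q4 : 1 / 4 <= expR (-1) :> R by nra.
  (* k <= 10 ln n gives 3/100, and e <= 4 gives e^-2 >= 1/16. *)
  apply: (@le_trans _ _ (3 / 100)); last by nra.
  by rewrite ler_pdivrMr; lra.
have f0 : 0 < (m.+1)`!%:R :> R by rewrite ltr0n fact_gt0.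
have c_le : #|Lvertex n|%:R <= n%:R ^+ 2 :> R.
  by rewrite -natrX ler_nat card_Lvertex_le.
have step : (m.+1)`!%:R * P <= n%:R ^+ 2 * (k ^+ m * expR (- m%:R) * expR (- m%:R)).
  apply: le_trans main _; apply: ler_pM => //; first by rewrite exprn_ge0.
  have -> : - (m%:R) = m%:R * (-1) :> R by rewrite mulrN1.
  rewrite expRM_natl -!exprMn; apply: lerXn2r; rewrite ?nnegrE //.
    by rewrite !mulr_ge0 ?expR_ge0 //; lra.
  apply: le_trans x_le _; rewrite -[leRHS]mulrA; apply: ler_wpM2l => //; lra.
have kf : k ^+ m * expR (- m%:R) <= expR 1 * (m.+1)`!%:R.
  have kk : k * k ^+ m <= expR m%:R * expR 1 * (m.+1)`!%:R.
    by rewrite -exprS -expRD natr1 expn_le_expR_fact.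
  have e0 := @expR_gt0 R m%:R.
  rewrite expRN ler_pdivrMr // [leRHS]mulrC mulrA.
  apply: le_trans kk; rewrite ler_peMl // exprn_ge0 //; lra.
rewrite -(ler_pM2l f0); apply: le_trans step _.
have -> : (m.+1)`!%:R * (n%:R ^+ 2 * expR 1 * expR (- m%:R)) =
  n%:R ^+ 2 * (expR 1 * (m.+1)`!%:R * expR (- m%:R)) :> R by ring.
by rewrite ler_wpM2l ?exprn_ge0 // ler_wpM2r ?expR_ge0.
Qed.

Lemma Pr_percolates_subcritical : 10 <= l ->
  p1 * p2 <= 1 / (1000 * n%:R * l) ->
  Pr p (fun F => `[< percolates (dgraph F) >]) <= 160 / n%:R.
Proof.
move=> l10 pp.
have n0 : 0 < n%:R :> R.
  by rewrite ltNge; apply/negP => h; have := ln_le0 (le_trans h ler01); lra.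
have ln_n : l < n%:R by exact: ln_sublinear.
have p01 x : 0 <= p x <= 1 by exact: edge_prob01.
(* Sizes in the window satisfy m >= 4 ln n - 1, so that e^-m <= e n^-4, and m + 1 <= 2K <= 8 ln n +
   2 <= 10 ln n. *)
have [|K /andP[Kl Ku]] := @natr_above R (4 * l); first by lra.
have n11 : (10 < n)%N by rewrite -(ltr_nat R); lra.
have cV := card_Lvertex_ge n11.
have K5 : (K <= n * 5)%N by rewrite -(ler_nat R) natrM; lra.
have V0 : (0 < #|Lvertex n|)%N by rewrite (leq_trans _ cV) // muln_gt0 (leq_trans _ n11).
have [v0 _] := card_gt0P V0.
have K0 : (0 < K)%N by rewrite -(ltr0n R); lra.
have sub F : `[< percolates (dgraph F) >] ->
    [exists m : 'I_K.*2, (K <= m.+1)%N && [exists S : {set Lvertex n},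
    (#|S| == m.+1) && doubly_connected (dgraph F) S]].
  have KV : (0 < K <= #|Lvertex n|)%N by rewrite K0 (leq_trans K5).
  move=> /asboolP /percolates_doubly_connected /(_ KV)[S [dS /andP[KS SK]]].
  have S1 : (#|S|.-1 < K.*2)%N by rewrite (leq_ltn_trans (leq_pred _)).
  apply/existsP; exists (Ordinal S1) => /=.
  rewrite prednK; last exact: leq_trans KS.
  by rewrite KS; apply/existsP; exists S; rewrite eqxx.
apply: le_trans (le_Pr p01 sub) _; apply: le_trans (Pr_exists p01 _ _) _.
apply: (@le_trans _ _ (\sum_(m < K.*2) n%:R ^+ 2 * expR 1 * expR (1 - 4 * l))).
  rewrite big_mkcond; apply: ler_sum => m _; case: ifP => [Km|_]; last first.
    by rewrite !mulr_ge0 ?expR_ge0 ?exprn_ge0.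
  apply: le_trans (Pr_doubly_connected_line v0 _ _ pp) _; [|lra|].
    have mK : m.+1%:R <= K.*2%:R :> R by rewrite ler_nat.
    have KE : K.*2%:R = K%:R * 2 :> R by rewrite -muln2 natrM.
    lra.
  rewrite ler_wpM2l ?mulr_ge0 ?exprn_ge0 ?expR_ge0 // ler_expR.
  by move: Km; rewrite -(ler_nat R) -natr1; lra.
have e4 := expR1_le4 R; have e0 := @expR_gt0 R 1.
have nE : expR l = n%:R by rewrite lnK ?posrE.
rewrite sumr_const card_ord -[leLHS]mulr_natl -muln2 natrM expRD expRN.
have -> : expR (4 * l) = n%:R ^+ 4 by rewrite -[in RHS]nE -expRM_natl.
rewrite ler_pdivlMr //.
have -> : K%:R * 2 * (n%:R ^+ 2 * expR 1 * (expR 1 / n%:R ^+ 4)) * n%:R =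
   2 * (expR 1 * expR 1) * (K%:R / n%:R) :> R by field; rewrite gt_eqF.
(* The constant 160 is 2 * 4^2 * 5, from e <= 4 and the crude K <= 5n. *)
have : K%:R / n%:R <= 5 :> R by rewrite ler_pdivrMr // mulrC -natrM ler_nat.
have : 0 <= K%:R / n%:R :> R by rewrite divr_ge0.
set y := K%:R / n%:R; set e := expR 1 in e4 e0 *; nra.
Qed.

End Subcritical.

(** * The supercritical regime *)

Section Series.
Variable R : realType.

(** Telescoping of 1 / (a + 1) <= ln (a + 1) - ln a. *)
Lemma sum_inv_le K d : (0 < K)%N ->
  \sum_(K.+1 <= i < K.+1 + d) (i%:R^-1 : R) <= ln (K + d)%:R - ln K%:R.
Proof.
move=> K0; elim: d => [|d IH]; first by rewrite !addn0 big_geq // subrr.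
rewrite addnS big_nat_recr /= ?leq_addr //; apply: le_trans (lerD IH (lexx _)) _.
rewrite addnS addSn -addrAC lerD2r -lerBrDl.
have a0 : 0 < (K + d)%:R :> R by rewrite ltr0n addn_gt0 K0.
have aE : (K + d).+1%:R = (K + d)%:R + 1 :> R by rewrite -natr1.
rewrite aE; move: (K + d)%:R a0 => a a0; have ap : 0 < a + 1 by lra.
have := @le_ln1Dx R (- (a + 1)^-1).
have -> : 1 + - (a + 1)^-1 = a / (a + 1) by field; rewrite gt_eqF.
rewrite ln_div ?posrE // ltrN2 invf_lt1 // => h.
have {}h : ln a - ln (a + 1) <= - (a + 1)^-1 by apply: h; lra.
lra.
Qed.

(** Telescoping of 1 / (a + 1)^2 <= 1 / a - 1 / (a + 1). *)
Lemma sum_inv_sqr_le K d : (0 < K)%N ->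
  \sum_(K.+1 <= i < K.+1 + d) (i%:R^-1 ^+ 2 : R) <= K%:R^-1 - (K + d)%:R^-1.
Proof.
move=> K0; elim: d => [|d IH]; first by rewrite !addn0 big_geq // subrr.
rewrite addnS big_nat_recr /= ?leq_addr //; apply: le_trans (lerD IH (lexx _)) _.
rewrite addnS addSn -addrA lerD2l.
have a0 : 0 < (K + d)%:R :> R by rewrite ltr0n addn_gt0 K0.
have aE : (K + d).+1%:R = (K + d)%:R + 1 :> R by rewrite -natr1.
rewrite aE; move: (K + d)%:R a0 => a a0; have ap : 0 < a + 1 by lra.
rewrite -subr_ge0.
have -> : - (a + 1)^-1 - (- a^-1 + (a + 1)^-1 ^+ 2) = (a * (a + 1) ^+ 2)^-1.
  by field; rewrite !gt_eqF.
by rewrite invr_ge0 mulr_ge0 ?exprn_ge0 // ltW.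
Qed.

End Series.

(** * Probability that the exploration reaches the target size *)

Section ReachBound.
Variables (R : realType) (n T M K : nat) (p1 p2 : R).

Local Notation N := (n%:R).
Local Notation l := (@ln R n%:R).

Hypotheses (l10 : 10 <= l) (p1_01 : 0 < p1 <= 1) (p2_01 : 0 < p2 <= 1).
Hypothesis pp : 1000 / (N * l) <= p1 * p2.
Hypotheses (p1l : 1000 * l / N <= p1) (p2l : 1000 * l / N <= p2).
Hypotheses (Kl : l / 10 <= K%:R) (Ku : K%:R <= l / 10 + 1).
Hypotheses (nK : 64 * K%:R <= N :> R) (Tn : 3 / 8 * N <= T%:R :> R)
  (Mn : 40 * M%:R <= N :> R).

Local Notation r := (join_rate p1 p2).

Local Ltac assumptions :=
  move: (l10) (Kl) (Ku) (nK) (Tn) (Mn) => ? ? ? ? ? ?.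

Let n0 : 0 < N :> R.
Proof.
assumptions; rewrite ltNge; apply/negP => h.
by have := ln_le0 (le_trans h ler01); lra.
Qed.

Let r01 a : 0 <= r a <= 1.
Proof.
by case/andP: p1_01 p2_01 => h1 h2 /andP[h3 h4]; apply: join_rate01; rewrite ?h2 ?h4 ltW.
Qed.

(** Expanding (1 + 1/(i p1)) (1 + 1/(i p2)): the linear terms use the lower bounds on p1 and p2, the
    quadratic term the one on p1 p2. *)
Lemma inv_rate_bound i : (0 < i)%N -> 0 < r i /\
  (r i)^-1 <= 1 + N / (500 * l) * i%:R^-1 + N * l / 1000 * i%:R^-1 ^+ 2.
Proof.
assumptions; move=> i0; have [r0 ri] := inv_join_rate p1_01 p2_01 i0; split=> //.
apply: le_trans ri _; rewrite (invfM i%:R p1) (invfM i%:R p2).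
have l0 : 0 < l by lra.
have [a0 _] := andP p1_01; have [b0 _] := andP p2_01.
have A0 : 0 < p1^-1 by rewrite invr_gt0.
have B0 : 0 < p2^-1 by rewrite invr_gt0.
have q0 : 0 < 1000 * l / N by apply: divr_gt0; [lra|exact: n0].
have qE : (1000 * l / N)^-1 = N / (1000 * l) by rewrite invf_div.
have A1 : p1^-1 <= N / (1000 * l) by rewrite -qE lef_pV2 ?posrE.
have B1 : p2^-1 <= N / (1000 * l) by rewrite -qE lef_pV2 ?posrE.
have AB : p1^-1 * p2^-1 <= N * l / 1000.
  have pp' : 1000 <= p1 * p2 * (N * l).
    by rewrite -ler_pdivrMr; [exact: pp|apply: mulr_gt0].
  rewrite -invfM -[leLHS]mul1r ler_pdivrMr; last by apply: mulr_gt0.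
  have -> : N * l / 1000 * (p1 * p2) = (p1 * p2 * (N * l)) / 1000 by field.
  by lra.
have x0 : 0 < (i%:R^-1 : R) by rewrite invr_gt0 ltr0n.
set x := i%:R^-1 in x0 *.
have e1 : x * p1^-1 <= x * (N / (1000 * l)) by rewrite ler_pM2l.
have e2 : x * p2^-1 <= x * (N / (1000 * l)) by rewrite ler_pM2l.
have e3 : x ^+ 2 * (p1^-1 * p2^-1) <= x ^+ 2 * (N * l / 1000).
  by rewrite ler_pM2l // exprn_gt0.
have -> : N / (500 * l) = 2 * (N / (1000 * l)) by field; rewrite gt_eqF.
have -> : (1 + x * p1^-1) * (1 + x * p2^-1) =
  1 + (x * p1^-1 + x * p2^-1) + x ^+ 2 * (p1^-1 * p2^-1) by ring.
have -> : 1 + 2 * (N / (1000 * l)) * x + N * l / 1000 * x ^+ 2 =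
  1 + (x * (N / (1000 * l)) + x * (N / (1000 * l))) + x ^+ 2 * (N * l / 1000) by ring.
by rewrite lerD // lerD2l lerD.
Qed.

Let l0 : 0 < l. Proof. assumptions; lra. Qed.
Let K1 : (0 < K)%N. Proof. by assumptions; rewrite -(ltr0n R); lra. Qed.

(** The sums of 1/i and 1/i^2 above K are at most ln n and 10 / ln n, so the mean time from K + 1 to
    M is at most M + n/500 + n/100. This is below n/16, half of the available time. *)
Lemma reach_second_phase t : N / 8 <= t%:R :> R -> 1 / 2 <= reach r M t K.+1.
Proof.
assumptions; move=> tn.
have [MK|KM] := leqP M K.+1; first by rewrite reach_top //; lra.
have Mpos : 0 < M%:R :> R by rewrite ltr0n (leq_trans _ KM).
have rpos i : (K.+1 <= i < M)%N -> 0 < r i.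
  by move=> /andP[Ki _]; case: (@inv_rate_bound i) => //; rewrite (leq_trans _ Ki).
have mk := reach_markov r01 t rpos.
have c1 : 0 <= N / (500 * l) by apply: divr_ge0; [exact: ltW|lra].
have c2 : 0 <= N * l / 1000.
  by apply: divr_ge0; [apply: mulr_ge0; exact: ltW|lra].
have ME : M = (K.+1 + (M - K.+1))%N by rewrite subnKC // ltnW.
have bnd : \sum_(K.+1 <= i < M) (r i)^-1 <=
    M%:R + N / (500 * l) * l + N * l / 1000 * (10 / l).
  apply: (@le_trans _ _ (\sum_(K.+1 <= i < M)
      (1 + N / (500 * l) * i%:R^-1 + N * l / 1000 * i%:R^-1 ^+ 2))).
    rewrite big_nat [leRHS]big_nat; apply: ler_sum => i /andP[Ki _].
    by case: (@inv_rate_bound i) => //; rewrite (leq_trans _ Ki).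
  rewrite !big_split /= -!big_distrr /=; apply: lerD; first apply: lerD.
  - by rewrite sumr_const_nat ler_nat leq_subr.
  - apply: ler_wpM2l; first exact: c1.
    rewrite [X in \sum_(_ <= i < X) _]ME.
    apply: le_trans (sum_inv_le _ _ K1) _.
    have lK : 0 <= ln (K%:R : R) by rewrite ln_ge0 // ler1n.
    have Kd : (K + (M - K.+1) <= n)%N.
      have : (M <= n)%N by rewrite -(ler_nat R); lra.
      by apply: leq_trans; rewrite [leqRHS]ME addSn.
    have : ln (K + (M - K.+1))%:R <= l.
      by rewrite ler_ln ?posrE ?ler_nat // ltr0n addn_gt0 K1.
    lra.
  - apply: ler_wpM2l; first exact: c2.
    rewrite [X in \sum_(_ <= i < X) _]ME.
    apply: le_trans (sum_inv_sqr_le _ _ K1) _.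
    apply: (@le_trans _ _ K%:R^-1); first by rewrite lerBlDr lerDl invr_ge0.
    have -> : 10 / l = (l / 10)^-1 by rewrite invf_div.
    have l10' : 0 < l / 10 by lra.
    by rewrite lef_pV2 ?posrE ?ltr0n.
have E1 : N / (500 * l) * l = N / 500 :> R by field; rewrite gt_eqF.
have E2 : N * l / 1000 * (10 / l) = N / 100 :> R by field; rewrite gt_eqF.
rewrite E1 E2 in bnd.
have mk2 := le_trans mk bnd.
rewrite leNgt; apply/negP => small.
have : N / 8 * (1 / 2) < t%:R * (1 - reach r M t K.+1).
  set z := reach _ _ _ _ in small *; nra.
lra.
Qed.

(** It suffices that 1 + 1/(h r_i) <= 2 (K/i)^2. The three terms of the rate bound contribute at
    most 1/8, 8/2500 and 0.08 (K/i)^2, while (K/i)^2 >= 1. *)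
Lemma level_bound h i : (0 < i <= K)%N -> N <= 8 * K%:R * h%:R :> R ->
  (i%:R ^+ 2) / (2 * K%:R ^+ 2) <= 1 - (1 - r i) ^+ h.
Proof.
assumptions; move=> /andP[i0 iK] hK.
have [r0 rb] := inv_rate_bound i0.
have Kp : 0 < K%:R :> R by rewrite ltr0n.
have h0 : (0 < h)%N.
  by rewrite lt0n; apply/eqP => h0; move: hK; rewrite h0 mulr0; lra.
have hp : 0 < h%:R :> R by rewrite ltr0n.
have r1 : 0 < r i <= 1 by rewrite r0; case/andP: (r01 i).
have [q0 qb] := inv_one_sub_expr r1 h0.
have ip : 0 < i%:R :> R by rewrite ltr0n.
rewrite -[leRHS]invrK -[leLHS]invrK.
rewrite lef_pV2 ?posrE ?invr_gt0 ?divr_gt0 ?exprn_gt0 ?mulr_gt0 ?exprn_gt0 //.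
apply: le_trans qb _; rewrite invf_div invfM.
set x := i%:R^-1 in rb *.
have x0 : 0 < x by rewrite invr_gt0.
have xK : 1 <= (K%:R * x) ^+ 2.
  by apply: exprn_ege1; rewrite /x ler_pdivlMr // mul1r ler_nat.
have hi : h%:R^-1 <= 8 * K%:R / N :> R.
  by rewrite ler_pdivlMr // [leLHS]mulrC ler_pdivrMr //; lra.
have x1 : x <= 1 by rewrite invf_le1 // ler1n.
have -> : 2 * K%:R ^+ 2 / i%:R ^+ 2 = 2 * (K%:R * x) ^+ 2.
  by rewrite /x; field; rewrite gt_eqF.
have ri0 : 0 <= (r i)^-1 by rewrite invr_ge0 ltW.
have step : h%:R^-1 * (r i)^-1 <= 8 * K%:R / N *
    (1 + N / (500 * l) * x + N * l / 1000 * x ^+ 2).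
  by apply: ler_pM => //; rewrite invr_ge0 ltW.
have E : 8 * K%:R / N * (1 + N / (500 * l) * x + N * l / 1000 * x ^+ 2) =
   8 * K%:R / N + (8 / 500) * (K%:R / l) * x + (8 / 1000) * (K%:R * l) * x ^+ 2.
  by field; rewrite !gt_eqF.
rewrite E in step.
have s1 : 8 * K%:R / N <= 1 / 8 :> R by rewrite ler_pdivrMr //; lra.
have Kl5 : K%:R / l <= 1 / 5 by rewrite ler_pdivrMr //; lra.
have Kl0 : 0 <= K%:R / l by rewrite divr_ge0 // ltW.
have s2 : (8 / 500) * (K%:R / l) * x <= 8 / 2500 by nra.
have s3 : (8 / 1000) * (K%:R * l) * x ^+ 2 <= 8 / 100 * (K%:R * x) ^+ 2.
  have -> : 8 / 100 * (K%:R * x) ^+ 2 = 8 / 100 * (K%:R * K%:R) * x ^+ 2 by ring.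
  apply: ler_wpM2r; first by rewrite exprn_ge0 ?ltW.
  have : K%:R * l <= K%:R * (10 * K%:R) by rewrite ler_pM2l //; lra.
  lra.
lra.
Qed.

(** Each of the first K levels gets h = n / (4K) steps, which leaves at least n/8 for the second
    phase. The product of the level bounds is K!^2 / (2 K^2)^K, at least e^(-3K) because K^K <= e^K
    K! and 2 <= e. *)
Lemma reach_bound : expR (- (3 * K%:R)) / 2 <= reach r M T 1.
Proof.
assumptions; pose h := (n %/ (4 * K))%N.
have Kp : 0 < K%:R :> R by rewrite ltr0n.
have K4 : (0 < 4 * K)%N by rewrite muln_gt0.
have hN : N <= 8 * K%:R * h%:R :> R.
  have : (n < h.+1 * (4 * K))%N by rewrite mulSnr {1}(divn_eq n (4 * K)) ltn_add2l ltn_mod.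
  rewrite -(ltr_nat R) !natrM -natr1; nra.
have hK : K%:R * h%:R <= N / 4 :> R.
  have : (h * (4 * K) <= n)%N by exact: leq_divM.
  rewrite -(ler_nat R) !natrM; lra.
have hT : (K * h <= T)%N by rewrite -(ler_nat R) natrM; lra.
have TE : T = ((T - K * h) + K * h)%N by rewrite subnK.
rewrite TE; apply: le_trans (reach_levels _ r01 _ _ _ _).
have t2 : N / 8 <= (T - K * h)%:R :> R by rewrite natrB // natrM; lra.
rewrite add1n; apply: ler_pM; rewrite ?expR_ge0 ?invr_ge0 //; last first.
  by have := reach_second_phase t2; lra.
apply: (@le_trans _ _ (\prod_(1 <= i < K.+1) (i%:R ^+ 2 / (2 * K%:R ^+ 2)))); last first.
  rewrite big_nat [leRHS]big_nat; apply: ler_prod => i /andP[i1 iK].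
  by rewrite divr_ge0 ?mulr_ge0 ?exprn_ge0 //= level_bound // i1.
rewrite big_split /= prodr_const_nat subn1 /= prodrXl -natr_prod -fact_prod.
have kk := expn_le_expR_fact R K.
have f0 : 0 < K`!%:R :> R by rewrite ltr0n fact_gt0.
have e0 := @expR_gt0 R K%:R.
have e2 : 2 ^+ K <= expR K%:R :> R.
  rewrite -[K%:R]mulr1 expRM_natl; apply: lerXn2r; rewrite ?nnegrE ?expR_ge0 //.
  by have := @expR_ge1Dx R 1; lra.
have -> : expR (- (3 * K%:R)) = (expR K%:R ^+ 3)^-1 :> R by rewrite expRN expRM_natl.
rewrite exprVn ler_pdivlMr ?exprn_gt0 ?mulr_gt0 ?exprn_gt0 //.
rewrite mulrC ler_pdivrMr ?exprn_gt0 //.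
have -> : (2 * K%:R ^+ 2) ^+ K = 2 ^+ K * (K%:R ^+ K) ^+ 2 :> R.
  by rewrite exprMn -!exprM mulnC.
have -> : K`!%:R ^+ 2 * expR K%:R ^+ 3 = expR K%:R * (expR K%:R * K`!%:R) ^+ 2 :> R by ring.
apply: ler_pM; rewrite ?exprn_ge0 //.
by apply: lerXn2r; rewrite ?nnegrE ?exprn_ge0 ?mulr_ge0 // ltW.
Qed.

End ReachBound.

(** * Numerical estimates for the supercritical regime *)

Section SupercriticalEstimates.
Variable R : realType.
Implicit Types (N l p q x y : R).

Lemma expR_le_1D2x y : 0 <= y <= 1 / 2 -> expR y <= 1 + 2 * y.
Proof.
move=> /andP[y0 y1]; have h := @expR_ge1Dx R (- y).
have e0 := @expR_gt0 R y; have e1 := @expRxMexpNx_1 R y.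
move: h e0 e1; set a := expR y; set b := expR _ => h e0 e1.
have ay : a * (1 - y) <= 1 by rewrite -e1 ler_pM2l //; lra.
nra.
Qed.

(** After squaring, 4 l^2 / p^2 <= 4 l^3 N / 1000 <= N^2 / 6500, and 80^2 = 6400. *)
Lemma target_size_le N l p : 0 < p -> 0 < l -> 26 * l ^+ 3 <= N ->
  1000 <= p ^+ 2 * (N * l) -> 2 * l / p <= N / 80.
Proof.
move=> p0 l0 lN pN; have l3 : 0 < l ^+ 3 by exact: exprn_gt0.
have N0 : 0 < N by lra.
have z0 : 0 <= 2 * l / p by apply: divr_ge0; lra.
rewrite -ler_sqr ?nnegrE; [|exact: z0|lra].
have -> : (2 * l / p) ^+ 2 = 4 * l ^+ 2 / p ^+ 2 by field; rewrite gt_eqF.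
rewrite ler_pdivrMr; last exact: exprn_gt0.
have Nl : 0 < N * l by exact: mulr_gt0.
have a3 : 26 * 1000 * l ^+ 2 * (N * l) <= p ^+ 2 * N ^+ 2 * (N * l).
  have -> : 26 * 1000 * l ^+ 2 * (N * l) = 1000 * (N * (26 * l ^+ 3)) by ring.
  have -> : p ^+ 2 * N ^+ 2 * (N * l) = p ^+ 2 * (N * l) * (N * N) by ring.
  apply: ler_pM; [lra| |exact: pN|by rewrite ler_pM2l].
  by apply: mulr_ge0; lra.
rewrite ler_pM2r // in a3.
have -> : (N / 80) ^+ 2 * p ^+ 2 = p ^+ 2 * N ^+ 2 / 6400 by field.
have : 0 <= l ^+ 2 by exact: exprn_ge0 (ltW l0).
lra.
Qed.

(** Squared: q^2 >= e^(-6 - 3l/5) / 16 and p^2 >= 1000 / (N l) with N = e^l leave e^(2l/5) / l on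
    the right up to constants, and the assumption on e^(2l/5) makes this at least 9 l^2, since 9 *
    256 <= 3000. *)
Lemma link_rate_ge l p k : 0 < l -> 0 < p -> k <= l / 10 + 1 ->
  3 * expR 6 * l ^+ 3 <= expR (2 / 5 * l) -> 1000 / (expR l * l) <= p ^+ 2 ->
  3 * l <= expR (- (3 * k)) / 4 * p * (expR l / 4).
Proof.
move=> l0 p0 kl H4 pp; set N := expR l; set q := expR _ / 4.
have N0 : 0 < N by exact: expR_gt0.
have q0 : 0 <= q by apply: divr_ge0; [exact: expR_ge0|lra].
have qp0 : 0 <= q * p by apply: mulr_ge0 => //; exact: ltW.
rewrite -ler_sqr ?nnegrE; [|lra|by apply: mulr_ge0 => //; lra].
have q2 : expR (- 6) * expR (- (3 / 5 * l)) / 16 <= q ^+ 2.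
  have -> : q ^+ 2 = expR (- (6 * k)) / 16.
    rewrite /q exprMn -expRM_natl exprVn; congr (expR _ * _^-1); ring.
  by rewrite -expRD ler_pM2r ?ler_expR; [lra|rewrite invr_gt0; lra].
have eE : N = expR (2 / 5 * l) * expR (3 / 5 * l).
  by rewrite -expRD; congr expR; field.
have key : 9 * l ^+ 2 * (16 * 16) * l <= expR (- 6) * expR (- (3 / 5 * l)) * (1000 * N).
  rewrite eE !expRN; move: H4 (@expR_gt0 R (3 / 5 * l)) (@expR_gt0 R 6).
  move: (expR (2 / 5 * l)) (expR (3 / 5 * l)) (expR 6) => A B D H4 B0 D0.
  have -> : D^-1 / B * (1000 * (A * B)) = 1000 * (A / D) by field; rewrite !gt_eqF.
  have : 3 * l ^+ 3 <= A / D by rewrite ler_pdivlMr // mulrAC.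
  have -> : 9 * l ^+ 2 * (16 * 16) * l = 2304 * l ^+ 3 by ring.
  have : 0 < l ^+ 3 by exact: exprn_gt0.
  by clear; lra.
have -> : (q * p * (N / 4)) ^+ 2 = q ^+ 2 * p ^+ 2 * N ^+ 2 / 16 by field.
have -> : (3 * l) ^+ 2 = 9 * l ^+ 2 by ring.
have Nl : 0 < N * l by exact: mulr_gt0.
have E0 : 0 <= expR (- 6) * expR (- (3 / 5 * l)) :> R by apply: mulr_ge0; exact: expR_ge0.
move: key q2 E0; set Q := expR (- 6) * expR (- (3 / 5 * l)) => key q2 E0.
have key2 : 9 * l ^+ 2 * 16 <= Q / 16 * (1000 / (N * l)) * N ^+ 2.
  have -> : Q / 16 * (1000 / (N * l)) * N ^+ 2 = Q * (1000 * N) / (16 * l).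
    by field; rewrite !gt_eqF.
  rewrite ler_pdivlMr; [move: key; clear; lra|lra].
have key3 : Q / 16 * (1000 / (N * l)) * N ^+ 2 <= q ^+ 2 * p ^+ 2 * N ^+ 2.
  apply: ler_wpM2r; first exact: exprn_ge0 (ltW N0).
  apply: ler_pM; [| |exact: q2|exact: pp].
    by apply: divr_ge0; [exact: E0|lra].
  by apply: divr_ge0; [lra|exact: ltW].
by have := le_trans key2 key3; clear; lra.
Qed.

Lemma expr_one_sub_small N l p m : 0 <= p <= 1 -> 0 < l -> N = expR l ->
  1000 * l / N <= p -> N / 8 <= m%:R -> (1 - p) ^+ m <= N^-1 ^+ 4.
Proof.
move=> p01 l0 NE pl Nm; have N0 : 0 < N by rewrite NE expR_gt0.
have <- : expR (- (4 * l)) = N^-1 ^+ 4 by rewrite expRN expRM_natl -NE exprVn.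
apply: subr_expr_le => //; apply: (@le_trans _ _ (1000 * l / N * (N / 8))).
  have -> : 1000 * l / N * (N / 8) = 125 * l by field; rewrite gt_eqF.
  lra.
by apply: ler_pM; [apply: divr_ge0; lra|lra|exact: pl|exact: Nm].
Qed.

(** (1 + x)^n - 1 <= e^(nx) - 1 <= 2nx <= 2 n^-3. *)
Lemma connectivity_error n x : 2600 <= n%:R :> R -> 0 <= x -> x <= n%:R^-1 ^+ 4 ->
  n%:R * ((1 + x) ^+ n - 1) <= n%:R^-1.
Proof.
move=> N1 x0 xy; have N0 : 0 < n%:R :> R by lra.
have Ny : n%:R * n%:R^-1 = 1 :> R by rewrite divff // gt_eqF.
have y0 : 0 < n%:R^-1 :> R by rewrite invr_gt0.
have y1 : n%:R^-1 <= 1 / 2600 :> R.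
  by rewrite -[leLHS]div1r ler_pdivrMr; [lra|exact: N0].
have e1 := @expR_ge1Dx R x.
have ex : expR x ^+ n = expR (n%:R * x) by rewrite expRM_natl.
have h1 : (1 + x) ^+ n <= expR x ^+ n.
  by apply: lerXn2r => //; rewrite nnegrE ?expR_ge0 //; lra.
rewrite ex {ex} in h1; move: xy h1 N0 Ny y0 y1 {N1 e1}.
move: ((1 + x) ^+ n) (n%:R : R) => z N; move: N^-1 => y xy h1 N0 Ny y0 y1.
have nx : N * x <= y ^+ 3.
  have -> : y ^+ 3 = N * y ^+ 4 by rewrite [in RHS]exprS mulrA Ny mul1r.
  by rewrite ler_pM2l.
have y3 : y ^+ 3 <= y * (1 / 2600) * (1 / 2600).
  have -> : y ^+ 3 = y * y * y by ring.
  by apply: ler_pM; [nra|lra|apply: ler_pM; lra|lra].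
have h2 : expR (N * x) <= 1 + 2 * (N * x).
  by apply: expR_le_1D2x; rewrite mulr_ge0 ?(ltW N0) //=; lra.
have h3 : z - 1 <= 2 * y ^+ 3 by lra.
have h4 : N * (z - 1) <= N * (2 * y ^+ 3) by rewrite ler_pM2l.
apply: le_trans h4 _.
have -> : N * (2 * y ^+ 3) = (N * y) * (2 * y * y) by ring.
rewrite Ny; nra.
Qed.

End SupercriticalEstimates.

Lemma half_split n : (0 < n./2)%N -> exists (u0 : 'I_n) (us : seq 'I_n),
  [/\ uniq (u0 :: us), (size us).+1 = n./2 & #|unexplored u0 us| = (n - n./2)%N].
Proof.
move=> h0; pose s := [seq j : 'I_n <- enum 'I_n | (j < n./2)%N].
have su : uniq s by rewrite filter_uniq // enum_uniq.
have n2 : (n./2 <= n)%N by rewrite leq_half_double -addnn leqW // leq_addr.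
have ss : size s = n./2.
  rewrite -(size_map val) -(filter_map val (fun j => j < n./2)%N) val_enum_ord.
  have filt a b : [seq j <- iota 0 (a + b) | (j < a)%N] = iota 0 a.
    rewrite iotaD filter_cat add0n.
    have /all_filterP -> : all (fun j => j < a)%N (iota 0 a).
      by apply/allP => j; rewrite mem_iota.
    rewrite -[RHS]cats0; congr (_ ++ _); apply/eqP; rewrite -[_ == _]negbK -has_filter.
    by apply/hasPn => j; rewrite mem_iota -leqNgt => /andP[].
  have := filt n./2 (n - n./2)%N; rewrite subnKC // => ->.
  by rewrite size_iota.
case: s su ss => [|u0 us] su /= ss; first by rewrite -ss in h0.
exists u0, us; split=> //.
have := cardsC [set:: u0 :: us].
rewrite cardsE (card_uniqP su) /= ss card_ord => e.
by apply/eqP; rewrite -(eqn_add2l n./2) subnKC //; apply/eqP.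
Qed.

(** Each of the three failure terms is at most 1/n. As p1 is the larger probability, p1^2 >= p1 p2,
    which controls the target size and the link rate. *)
Lemma Pr_percolates_supercritical (R : realType) (n : nat) (p1 p2 : R) :
  0 <= p1 <= 1 -> 0 <= p2 <= 1 -> p2 <= p1 ->
  10 <= @ln R n%:R ->
  26 * @ln R n%:R ^+ 3 <= n%:R ->
  3 * expR 6 * @ln R n%:R ^+ 3 <= expR (2 / 5 * @ln R n%:R) ->
  1000 / (n%:R * ln n%:R) <= p1 * p2 -> 1000 * ln n%:R / n%:R <= p2 ->
  Pr (edge_prob p1 p2 (Ledge n)) (fun F => ~~ `[< percolates (dgraph F) >]) <=
  3 / n%:R.
Proof.
move=> p1_01 p2_01 p21 l10 H3 H4 pp p2l.
have l0 : 0 < @ln R n%:R by lra.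
have l31 : 100 * @ln R n%:R <= @ln R n%:R ^+ 3.
  move: (ln n%:R) l10 => l l10.
  have -> : l ^+ 3 = l * l * l by ring.
  by apply: ler_wpM2r; nra.
have N1 : 2600 <= n%:R :> R by lra.
have N0 : 0 < n%:R :> R by lra.
have NE : n%:R = expR (ln n%:R) :> R by rewrite lnK ?posrE.
have [p10 p11] := andP p1_01; have [p20 p21'] := andP p2_01.
have q0 : 0 < 1000 * ln n%:R / n%:R :> R by apply: divr_gt0 N0; move: l0; clear; lra.
have p2p : 0 < p2 := lt_le_trans q0 p2l.
have p1p : 0 < p1 := lt_le_trans p2p p21.
have p1l := le_trans p2l p21.
have p1sq : 1000 / (n%:R * ln n%:R) <= p1 ^+ 2.
  by apply: le_trans pp _; rewrite expr2 ler_wpM2l.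
have Nl : 0 < n%:R * @ln R n%:R by exact: mulr_gt0.
have p1sq' : 1000 <= p1 ^+ 2 * (n%:R * ln n%:R) by rewrite -ler_pdivrMr.
have mp : 0 <= 2 * ln n%:R / p1 by apply: divr_ge0 (ltW p1p); move: l0; clear; lra.
have [K /andP[Kl Ku]] : exists K : nat, @ln R n%:R / 10 <= K%:R <= @ln R n%:R / 10 + 1.
  by apply: natr_above; move: l0; clear; lra.
(* M >= 2 ln n / p1 gives (1 - p1)^M <= n^-2, so all leaves see a set of this size in red except
   with probability 1/n. *)
have [M /andP[Ml Mu]] := natr_above mp.
have Mn : 40 * M%:R <= n%:R :> R.
  by have := target_size_le p1p l0 H3 p1sq'; move: Mu N1; clear; lra.
have nK : 64 * K%:R <= n%:R :> R by move: Ku l10 l31 H3; clear; lra.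
have n20 : (20 <= n)%N by rewrite -(ler_nat R); move: N1; clear; lra.
have V0 : (0 < #|Lvertex n|)%N.
  by rewrite (leq_trans _ (card_Lvertex_ge _)) ?muln_gt0 ?(leq_trans _ n20).
have [v0 _] := card_gt0P V0.
have h0 : (0 < n./2)%N by rewrite half_gt0 (leq_trans _ n20).
have [u0 [us [us_uniq us_size WE]]] := half_split h0.
have nhalf : n%:R <= n./2%:R * 2 + 1 :> R.
  rewrite -natrM natr1 ler_nat muln2 -{1}(odd_double_half n) -add1n leq_add2r.
  exact: leq_b1.
have halfn : n./2%:R * 2 <= n%:R :> R.
  by rewrite -natrM ler_nat muln2 -{2}(odd_double_half n) leq_addl.
have Tn : 3 / 8 * n%:R <= (size us)%:R :> R.
  have : (size us)%:R + 1 = n./2%:R :> R by rewrite natr1 us_size.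
  by move: nhalf N1; clear; lra.
have WN : n%:R / 2 <= #|unexplored u0 us|%:R :> R.
  rewrite WE natrB; first by move: halfn; clear; lra.
  by rewrite -(ler_nat R); move: halfn N0; clear; lra.
have rb := @reach_bound R n (size us) M K p1 p2 l10 _ _ pp p1l p2l Kl Ku nK Tn Mn.
rewrite p1p p2p p11 p21' in rb; have {}rb := rb isT isT.
have smallM : (1 - p1) ^+ M <= n%:R ^- 2.
  have -> : n%:R ^- 2 = expR (- (2 * ln n%:R)) :> R.
    by rewrite expRN expRM_natl -NE.
  by apply: subr_expr_le => //; rewrite [leRHS]mulrC -ler_pdivrMr.
(* One factor 1/2 comes from the second phase of the chain, the other from 1 - n (1 - p1)^M >=
   1/2. *)
pose q := expR (- (3 * K%:R)) / 4 : R.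
have q_ge0 : 0 <= q by apply: divr_ge0; rewrite ?expR_ge0.
have qP g : g \in unexplored u0 us ->
    q <= Pr (edge_prob p1 p2 (Ledge n)) (good_star v0 u0 us M g).
  move=> gW; apply: le_trans (Pr_good_star v0 M us_uniq p1_01 p2_01 gW).
  have -> : q = expR (- (3 * K%:R)) / 2 * (1 / 2) by rewrite /q; field.
  apply: ler_pM; [by apply: divr_ge0; rewrite ?expR_ge0|by clear; lra|exact: rb|].
  have : n%:R * (1 - p1) ^+ M <= n%:R * n%:R ^- 2 by rewrite ler_pM2l.
  have -> : n%:R * n%:R ^- 2 = n%:R^-1 :> R by field; rewrite gt_eqF.
  have : n%:R^-1 <= 2^-1 :> R by rewrite lef_pV2 ?posrE //; move: N1; clear; lra.
  by clear; lra.
have link := link_rate_ge l0 p1p Ku H4; rewrite -NE in link.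
have {}link := link p1sq.
move: WN WE qP; set W := #|unexplored u0 us| => WN WE qP.
have W0 : (3 <= W)%N by rewrite -(ler_nat R); move: WN N1; clear; lra.
have W1 : W.-1%:R = W%:R - 1 :> R.
  by rewrite -subn1 natrB // (leq_trans _ W0).
have W2 : (W - 2)%:R = W%:R - 2 :> R by rewrite natrB // (leq_trans _ W0).
pose k := (W.-1)./2.
have kW : (k.*2 <= W.-1)%N by rewrite -[leqRHS](odd_double_half W.-1) leq_addl.
have kN : n%:R / 8 <= k%:R :> R.
  have : W.-1%:R <= k%:R * 2 + 1 :> R.
    rewrite -natrM natr1 ler_nat muln2 -[leqLHS](odd_double_half W.-1) -add1n leq_add2r.
    exact: leq_b1.
  by rewrite W1; move: WN N1; clear; lra.
have WN1 : n%:R / 8 <= W.-1%:R :> R by rewrite W1; move: WN N1; clear; lra.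
have W0' : (0 < W)%N by rewrite (leq_trans _ W0).
apply: le_trans (Pr_not_percolates p1_01 p2_01 q_ge0 W0' kW qP) _.
rewrite -/W.
have t1 : n%:R * ((1 + (1 - p2) ^+ k) ^+ n - 1) <= n%:R^-1.
  apply: connectivity_error => //; first by rewrite exprn_ge0 // subr_ge0.
  exact: expr_one_sub_small NE p2l kN.
have Ny : n%:R * n%:R^-1 = 1 :> R by rewrite divff // gt_eqF.
have y0 : 0 < n%:R^-1 :> R by rewrite invr_gt0.
have y1 : n%:R^-1 <= 1 / 2600 :> R.
  by rewrite -[leLHS]div1r ler_pdivrMr; [move: N1; clear; lra|exact: N0].
have t2 : n%:R ^+ 2 * ((1 - p1) ^+ W.-1 + (1 - p2) ^+ W.-1) <= n%:R^-1.
  have h1 := expr_one_sub_small p1_01 l0 NE p1l WN1.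
  have h2 := expr_one_sub_small p2_01 l0 NE p2l WN1.
  have := lerD h1 h2; rewrite -(@ler_pM2l _ (n%:R ^+ 2)) ?exprn_gt0 // => h.
  apply: le_trans h _; move: Ny y0 y1; clear.
  move: (n%:R : R) => N; move: N^-1 => y Ny y0 y1.
  have -> : N ^+ 2 * (y ^+ 4 + y ^+ 4) = (N * y) ^+ 2 * (2 * y * y) by ring.
  rewrite Ny; nra.
have t3 : n%:R ^+ 2 * (1 - q * p1) ^+ (W - 2) <= n%:R^-1.
  have [w wW] := card_gt0P W0'.
  have q1 : q <= 1.
    by apply: le_trans (qP w wW) _; apply: Pr_le1 => x; exact: edge_prob01.
  (* The exponent 3 ln n leaves 1/n after the n^2 pairs; W - 2 >= n/4 is enough candidates g. *)
  have h : (1 - q * p1) ^+ (W - 2) <= expR (- (3 * ln n%:R)).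
    apply: subr_expr_le; first by rewrite mulr_ge0 // mulr_ile1.
    apply: le_trans link _; apply: ler_wpM2l; first exact: mulr_ge0.
    by rewrite W2; move: WN N1; clear; lra.
  have e3 : expR (- (3 * ln n%:R)) = n%:R^-1 ^+ 3 :> R.
    by rewrite expRN expRM_natl -NE exprVn.
  rewrite e3 -(@ler_pM2l _ (n%:R ^+ 2)) ?exprn_gt0 // in h.
  apply: le_trans h _; move: Ny; clear.
  move: (n%:R : R) => N; move: N^-1 => y Ny.
  have -> : N ^+ 2 * y ^+ 3 = (N * y) ^+ 2 * y by ring.
  by rewrite Ny expr1n mul1r.
by move: t1 t2 t3; clear; lra.
Qed.

(** * Passage to the limit *)

Import numFieldNormedType.Exports.

Local Open Scope classical_set_scope.
Local Open Scope ring_scope.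

Section Limits.
Variable R : realType.

Lemma cvg_to1_of_error (C : R) (f : nat -> R) : 0 < C ->
  (\forall n \near \oo, 1 - C / n%:R <= f n <= 1) -> f @ \oo --> (1 : R).
Proof.
move=> C0 fC; apply/cvgrPdist_le => e e0; near=> n.
have /andP[h1 h2] : 1 - C / n%:R <= f n <= 1 by near: n.
rewrite ger0_norm ?subr_ge0 // (le_trans (_ : _ <= C / n%:R)) ?lerBlDl //.
  by rewrite -lerBlDr.
have nC : C / e < n%:R by near: n; exact: nbhs_infty_gtr.
have n0 : 0 < n%:R :> R by apply: lt_trans nC; exact: divr_gt0.
by rewrite ler_pdivrMr // mulrC -ler_pdivrMr // ltW.
Unshelve. all: by end_near. Qed.

Lemma near_ln_ge (L : R) : \forall n \near \oo, L <= ln n%:R.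
Proof.
near=> n; have nL : expR L < n%:R by near: n; exact: nbhs_infty_gtr.
have n0 : 0 < n%:R :> R := lt_trans (expR_gt0 L) nL.
by rewrite -ler_expR lnK ?posrE // ltW.
Unshelve. all: by end_near. Qed.

(** The term of order k + 1 of the exponential series suffices: L is chosen so that (a l)^(k + 1) /
    (k + 1)! >= C l^k once l >= L. *)
Lemma near_poly_ln_le_expR (C a : R) k : 0 < C -> 0 < a ->
  \forall n \near \oo, C * ln n%:R ^+ k <= expR (a * ln n%:R).
Proof.
move=> C0 a0; pose L := C * k.+1`!%:R / a ^+ k.+1.
have f0 : 0 < k.+1`!%:R :> R by rewrite ltr0n fact_gt0.
have L0 : 0 < L by rewrite divr_gt0 ?mulr_gt0 ?exprn_gt0.
near=> n; have lL : L <= ln n%:R by near: n; exact: near_ln_ge.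
move: (ln n%:R) lL => l lL; have l0 : 0 < l := lt_le_trans L0 lL.
have := @expR_ge1Dxn R (a * l) k (ltW (mulr_gt0 a0 l0)).
apply: le_trans; rewrite -[leLHS]add0r lerD // ler_pdivlMr // exprMn.
have -> : a ^+ k.+1 * l ^+ k.+1 = l * a ^+ k.+1 * l ^+ k.
  by rewrite [l ^+ k.+1]exprS mulrCA mulrA.
move: lL; rewrite ler_pdivrMr ?exprn_gt0 // => lL.
by rewrite mulrAC ler_wpM2r // exprn_ge0 // ltW.
Unshelve. all: by end_near. Qed.

End Limits.

Lemma L_prob_swap (R : realType) n (p1 p2 : R) :
  L_prob p1 p2 (fun H => @percolates (Lvertex n) H) =
  L_prob p2 p1 (fun H => @percolates (Lvertex n) H).
Proof.
rewrite /L_prob; under eq_bigr do rewrite big_mkcond /=.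
under [RHS]eq_bigr do rewrite big_mkcond /=.
rewrite exchange_big /=; apply: eq_bigr => F1 _; apply: eq_bigr => F2 _.
have -> : `[< percolates (DoubleGraph F2 F1) >] = `[< percolates (DoubleGraph F1 F2) >].
  by apply/asboolP/asboolP; exact: percolates_swap.
by case: ifP => // _; rewrite mulrC.
Qed.

Lemma L_prob_supercritical (R : realType) n (p1 p2 : R) :
  0 <= p1 <= 1 -> 0 <= p2 <= 1 ->
  10 <= @ln R n%:R -> 26 * @ln R n%:R ^+ 3 <= n%:R ->
  3 * expR 6 * @ln R n%:R ^+ 3 <= expR (2 / 5 * @ln R n%:R) ->
  1000 / (n%:R * ln n%:R) <= p1 * p2 -> 1000 * ln n%:R / n%:R <= Num.min p1 p2 ->
  1 - 3 / n%:R <= L_prob p1 p2 (fun H => @percolates (Lvertex n) H) <= 1.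
Proof.
(* All hypotheses are symmetric in the two colours. The comparison is made for each n separately, so
   the larger probability may alternate with n. *)
wlog p21 : p1 p2 / p2 <= p1 => [wl|] h1 h2 l10 H3 H4 pp pm.
  have [p21|/ltW p12] := leP p2 p1; first exact: wl.
  by rewrite L_prob_swap; apply: wl => //; rewrite 1?[p2 * p1]mulrC 1?minC.
rewrite L_probE.
have p01 x : 0 <= edge_prob p1 p2 (Ledge n) x <= 1 by exact: edge_prob01.
rewrite (Pr_le1 p01) andbT.
have p2l : 1000 * ln n%:R / n%:R <= p2 by move: pm; rewrite le_min => /andP[].
have := Pr_percolates_supercritical h1 h2 p21 l10 H3 H4 pp p2l.
by rewrite Pr_predC lerBlDr -lerBlDl.
Qed.

Theorem theorem4p1 (R : realType) :
  exists2 c : R, 0 < c &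
    forall p1 p2 : nat -> R,
      (forall n, 0 <= p1 n <= 1) -> (forall n, 0 <= p2 n <= 1) ->
      ((\forall n \near \oo, p1 n * p2 n <= 1 / (c * n%:R * ln n%:R)) ->
        (fun n => @L_prob R n (p1 n) (p2 n) (fun H => ~ percolates H))
          @ \oo --> (1 : R))
      /\
      ((\forall n \near \oo, p1 n * p2 n >= c / (n%:R * ln n%:R)) ->
       (\forall n \near \oo, Num.min (p1 n) (p2 n) >= c * ln n%:R / n%:R) ->
        (fun n => @L_prob R n (p1 n) (p2 n) (fun H => percolates H))
          @ \oo --> (1 : R)).
Proof.
(* One constant serves both regimes: it gives 3/100 <= e^-2 in the tree bound and makes the inverse
   join rates sum to less than n/16. *)
exists 1000; first by lra.
move=> p1 p2 p1_01 p2_01; split=> [pp|pp pm].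
- apply: (@cvg_to1_of_error _ 160); first by lra.
  near=> n.
  have l10 : 10 <= @ln R n%:R by near: n; exact: near_ln_ge.
  have ppn : p1 n * p2 n <= 1 / (1000 * n%:R * ln n%:R) by near: n.
  have p01 x : 0 <= edge_prob (p1 n) (p2 n) (Ledge n) x <= 1 by exact: edge_prob01.
  rewrite L_probE (Pr_le1 p01) andbT.
  rewrite (eq_Pr _ (Q := fun F => ~~ `[< percolates (dgraph F) >])); last first.
    by move=> F; rewrite asbool_neg.
  have := Pr_percolates_subcritical (p1_01 n) (p2_01 n) l10 ppn.
  by rewrite Pr_predC lerD2l lerN2.
- apply: (@cvg_to1_of_error _ 3); first by lra.
  near=> n.
  have n1 : 1 < n%:R :> R by near: n; exact: nbhs_infty_gtr.
  have n0 : 0 < n%:R :> R by lra.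
  apply: L_prob_supercritical => //.
  + by near: n; exact: near_ln_ge.
  + have h : 26 * @ln R n%:R ^+ 3 <= expR (1 * ln n%:R).
      by near: n; apply: near_poly_ln_le_expR; lra.
    by rewrite mul1r lnK ?posrE // in h.
  + near: n; apply: near_poly_ln_le_expR; last by lra.
    by apply: mulr_gt0; [lra|exact: expR_gt0].
  + by near: n.
  + by near: n.
Unshelve. all: by end_near. Qed.
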